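(* Let $k_0$ be a field with a discrete valuation $v_0$ whose residue field has characteristic $\neq 2$. Let $E_1, \dots, E_n$ be elliptic curves over $k_0$ given in Legendre form $$y_i^2 = x_i(x_i-1)(x_i-\lambda_i), \qquad \lambda_i \in k_0 \setminus \{0,1\},$$ with $v_0(\lambda_i) > 0$ for all $1 \leq i \leq n$. Let $Y = E_1 \times \cdots \times E_n$ and let $k/k_0$ be an algebraically closed field extension. Then the class $$\gamma = (x_1)\cdots(x_n) \in H^n(k(Y), \mu_2^{\otimes n})$$ is nontrivial, where $k(Y)$ is the function field of the base change of $Y$ to $k$.
   Context: $H^n(F,\mu_2^{\otimes n})$ denotes Galois cohomology of a field $F$ of characteristic $\neq 2$. For $a \in F^\times$, $(a) \in H^1(F,\mu_2) = F^\times/F^{\times 2}$ is its square class, and $(a_1)\cdots(a_n) \in H^n(F,\mu_2^{\otimes n})$ is the cup product. Each $x_i$ is regarded as a rational function on $E_i$, and hence on $Y$ via projection. The square class $(x_i) \in H^1(k(E_i),\mu_2)$ is the image of a nontrivial class $\gamma_i\in H^1_{\mathrm{\acute{e}t}}(E_i,\mu_2)$ (with $E_i$ base changed to $k$), and $\gamma$ is the restriction to the generic point of $Y$ of the cup product $\gamma_1\cdots\gamma_n \in H^n_{\mathrm{\acute{e}t}}(Y,\mu_2^{\otimes n})$. *)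

(* Defs.v *)
From HB Require Import structures.
From mathcomp Require Import all_boot all_order all_algebra all_field.
From mathcomp Require Import boolp classical_sets functions.
From mathcomp Require Import mpoly.

Set Implicit Arguments.
Unset Strict Implicit.
Unset Printing Implicit Defensive.

Import Order.TTheory GRing.Theory Num.Theory.

Local Open Scope ring_scope.
Local Open Scope quotient_scope.

(* Normalised discrete valuations.  By convention v(0) = +oo, so the value
   of [dval] at 0 is junk and the axioms only concern nonzero arguments. *)
Record discrete_valuation (K : fieldType) := DiscreteValuation {
  dval :> K -> int;
  dvalM : forall x y, x != 0 -> y != 0 -> dval (x * y) = dval x + dval y;
  dvalD : forall x y, x != 0 -> y != 0 -> x + y != 0 ->
    Num.min (dval x) (dval y) <= dval (x + y);
  dval_surj : forall m : int, exists2 x, x != 0 & dval x = m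
}.

Section ResidueField.
Variables (K : fieldType) (v : discrete_valuation K).

Definition valuation_pred : {pred K} := fun x => (x == 0) || (0 <= v x).

Lemma dval1 : v 1 = 0.
Proof.
have := dvalM v (oner_neq0 K) (oner_neq0 K).
by rewrite mulr1 => /esym/eqP; rewrite -subr_eq0 addrK => /eqP.
Qed.

Lemma dvalV x : x != 0 -> v x^-1 = - v x.
Proof.
move=> x0; apply/eqP; rewrite -addr_eq0 -dvalM ?invr_eq0 //.
by rewrite mulVf // dval1.
Qed.

Lemma dvalN x : v (- x) = v x.
Proof.
have [->|x0] := eqVneq x 0; first by rewrite oppr0.
have N1 : (- 1 : K) != 0 by rewrite oppr_eq0 oner_neq0.
have : v (- 1) + v (- 1) = 0 by rewrite -dvalM // mulrNN mulr1 dval1.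
rewrite -mulr2n => /eqP; rewrite mulrn_eq0 /= => /eqP vN1.
by rewrite -mulN1r dvalM // vN1 add0r.
Qed.

Lemma valuation_subring_closed : subring_closed valuation_pred.
Proof.
split=> [|x y|x y]; rewrite /in_mem /= /valuation_pred.
- by rewrite dval1 lexx orbT.
- have [->|x0] := eqVneq x 0.
    by rewrite sub0r oppr_eq0 dvalN.
  have [->|y0] := eqVneq y 0; first by rewrite subr0 (negPf x0).
  move=> /= vx vy; have [//|xy] := eqVneq (x - y) 0.
  apply: le_trans (dvalD v x0 _ xy); last by rewrite oppr_eq0.
  by rewrite le_min dvalN vx vy.
- have [->|x0] := eqVneq x 0; first by rewrite mul0r eqxx.
  have [->|y0] := eqVneq y 0; first by rewrite mulr0 eqxx.
  by move=> vx vy; rewrite dvalM // addr_ge0 ?orbT.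
Qed.

HB.instance Definition _ :=
  GRing.isSubringClosed.Build K valuation_pred valuation_subring_closed.

Record valuation_ring := ValuationRing {
  vring_val :> K;
  vring_valP : vring_val \in valuation_pred
}.

HB.instance Definition _ := [isSub for vring_val].
HB.instance Definition _ := [Choice of valuation_ring by <:].
HB.instance Definition _ := [SubChoice_isSubComNzRing of valuation_ring by <:].

Definition valuation_ideal : {pred valuation_ring} :=
  fun x => (val x == 0) || (0 < v (val x)).

Lemma valuation_ideal_closed : idealr_closed valuation_ideal.
Proof.
split; rewrite /in_mem /= /valuation_ideal.
- by rewrite /= eqxx.
- by rewrite /= dval1 ltxx oner_eq0.
move=> [a /= va] [x /= vx'] [y /= vy']; rewrite /in_mem /= => vx vy.
have {va vx vx'} : (a * x == 0) || (0 < v (a * x)).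
  move: va; rewrite /in_mem /= /valuation_pred.
  have [->|a0] := eqVneq a 0; first by rewrite mul0r eqxx.
  move: vx; have [->|x0] := eqVneq x 0; first by rewrite mulr0 eqxx.
  by move=> /= vx va; rewrite dvalM // ltr_wpDl // orbT.
move: (a * x) vy => z; have [-> vy _|z0] := eqVneq z 0; first by rewrite add0r.
have [->|y0] := eqVneq y 0; first by rewrite addr0 (negPf z0).
move=> /= vy vz; have [//|zy] := eqVneq (z + y) 0.
by apply: lt_le_trans (dvalD v z0 y0 zy); rewrite lt_min vz vy.
Qed.

HB.instance Definition _ :=
  isIdealr.Build valuation_ring valuation_ideal valuation_ideal_closed.

(* Only the ring structure is declared; that it is a field is
   [residue_field_inv]. *)
Definition residue_field : comNzRingType := {ideal_quot valuation_ideal}.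

Lemma residue_field_inv (z : residue_field) :
  z != 0 -> exists w : residue_field, w * z = 1.
Proof.
elim/quotW: z => z.
rewrite -[0 in X in X -> _](rmorph0 \pi_residue_field) -Quotient.idealrBE subr0.
rewrite /in_mem /= /valuation_ideal negb_or => /andP[z0 vz].
have vz0 : v (\val z) = 0.
  move: (vring_valP z); rewrite /in_mem /= /valuation_pred (negPf z0) /= => vz'.
  by apply/eqP; rewrite eq_le vz' andbT leNgt.
have zV : (\val z)^-1 \in valuation_pred.
  by rewrite /in_mem /= /valuation_pred dvalV // vz0 oppr0 lexx orbT.
exists (\pi_residue_field (ValuationRing zV)); rewrite -rmorphM -[1](rmorph1 \pi_residue_field).
by congr (\pi_residue_field _); apply: val_inj; rewrite /= mulVf.
Qed.

End ResidueField.

(* Inhomogeneous cochains of a group G with values in a commutative ring R on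
   which G acts trivially. *)
Section Cochains.
Variables (G : groupType) (R : comNzRingType).

Definition cochain n := ('I_n -> G) -> R.

HB.instance Definition _ n := GRing.Zmodule.on (cochain n).

(* [face i] drops s_0 for i = 0, replaces the pair (s_(i-1), s_i) by its
   product for 0 < i <= n, and drops s_n for i = n+1. *)
Definition face n (i : nat) (s : 'I_n.+1 -> G) : 'I_n -> G := fun k =>
  if (k.+1 < i)%N then s (widen_ord (leqnSn n) k)
  else if k.+1 == i then (s (widen_ord (leqnSn n) k) * s (lift ord0 k))%g
  else s (lift ord0 k).

Definition coboundary n (f : cochain n) : cochain n.+1 :=
  fun s => \sum_(i < n.+2) (-1) ^+ i * f (face i s).

Definition cup m n (f : cochain m) (g : cochain n) : cochain (m + n) :=
  fun s => f (fun i => s (lshift n i)) * g (fun i => s (rshift m i)).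

Lemma coboundaryB n : {morph @coboundary n : f g / f - g}.
Proof.
move=> f g; apply/funext => s; rewrite /coboundary.
transitivity (\sum_(i < n.+2) ((-1) ^+ i * f (face i s) - (-1) ^+ i * g (face i s))).
  by apply: eq_bigr => i _; rewrite -mulrBr.
by rewrite sumrB.
Qed.

HB.instance Definition _ n :=
  GRing.isZmodMorphism.Build (cochain n) (cochain n.+1) (@coboundary n)
    (@coboundaryB n).

Section Leibniz.
Variables (m n : nat) (f : cochain m) (g : cochain n) (s : 'I_(m + n).+1 -> G).

Let sL : 'I_m.+1 -> G := fun i => s (lshift n i : 'I_(m.+1 + n)).
Let sR : 'I_n.+1 -> G := fun i => s (cast_ord (addnS m n) (rshift m i)).

Lemma face_lshift i : (i <= m.+1)%N ->
  (fun k => face i s (lshift n k)) = face i sL.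
Proof.
move=> im; apply/funext => k; rewrite /face /sL /=.
by case: ifP => _; [|case: ifP => _; [congr (_ * _)%g|]];
  congr s; apply: val_inj.
Qed.

Lemma face_rshift_small i : (i <= m)%N ->
  (fun k => face i s (rshift m k)) = face 0 sR.
Proof.
move=> im; apply/funext => k; rewrite /face /sR /=.
rewrite ltnNge (leq_trans im) ?leqW ?leq_addr //=.
rewrite gtn_eqF ?ltnS ?(leq_trans im) ?leq_addr //.
by congr s; apply: val_inj; rewrite /= /bump /= !add1n addnS.
Qed.

Lemma face_lshift_big i : (m < i)%N ->
  (fun k => face i s (lshift n k)) = face m.+1 sL.
Proof.
move=> im; apply/funext => k; rewrite /face /sL /=.
rewrite ltnS (leq_trans _ im) ?ltnS ?ltn_ord //.
by congr s; apply: val_inj.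
Qed.

Lemma face_rshift i :
  (fun k => face (m + i) s (rshift m k)) = face i sR.
Proof.
apply/funext => k; rewrite /face /sR /= -addnS ltn_add2l eqn_add2l.
by case: ifP => _; [|case: ifP => _; [congr (_ * _)%g|]];
  congr s; apply: val_inj; rewrite /= /bump /= ?add1n ?addnS.
Qed.

Lemma coboundary_cup :
  coboundary (cup f g) s =
  cup (coboundary f) g s + (-1) ^+ m * (f (fun k => sL (widen_ord (leqnSn m) k)) *
    coboundary g sR).
Proof.
have fE : (fun k => sL (widen_ord (leqnSn m) k)) = face m.+1 sL.
  by apply/funext => k; rewrite /face ltnS ltn_ord.
have gE : (fun i => s (rshift m.+1 i)) = face 0 sR.
  apply/funext => k; rewrite /face /sR /=; congr s; apply: val_inj => /=.
  by rewrite /bump /= add1n addnS.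
rewrite fE /cup gE -/sL /coboundary.
rewrite -(big_mkord xpredT (fun i => (-1) ^+ i *
  (f (fun k => face i s (lshift n k)) * g (fun k => face i s (rshift m k))))).
rewrite (big_cat_nat (n := m.+1)) //=; last by rewrite !ltnS leqW // leq_addr.
rewrite [in RHS]big_ord_recr /= mulrDl -addrA; congr (_ + _).
  rewrite big_mkord mulr_suml; apply: eq_bigr => i _.
  rewrite face_lshift; last by rewrite ltnW // ltn_ord.
  by rewrite face_rshift_small ?mulrA // -ltnS.
rewrite -{1}[m.+1]add0n big_addn subSS -addnS addKn.
rewrite [in RHS]big_ord_recl /= expr0 mul1r mulrDr mulrDr addrA.
rewrite exprS mulN1r !mulNr mulrA addNr add0r big_mkord !mulr_sumr.
apply: eq_bigr => i _; rewrite face_lshift_big ?leq_addl //.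
rewrite [in LHS](_ : (i + m.+1)%N = (m + i.+1)%N); last first.
  by rewrite !addnS addnC.
rewrite face_rshift /bump /= add1n exprD.
rewrite -!mulrA; congr (_ * _); rewrite mulrCA; congr (_ * _).
Qed.

End Leibniz.

End Cochains.

Definition is_separable_closure (F Fs : fieldType) (j : {rmorphism F -> Fs}) :=
  (forall z : Fs, exists2 p : {poly F}, separable_poly p & root (map_poly j p) z) /\
  (forall p : {poly Fs}, separable_poly p -> (1 < size p)%N -> exists z, root p z).

Section AbsoluteGalois.
Variables (F Fs : fieldType) (j : {rmorphism F -> Fs}).

Definition is_aut (f : Fs -> Fs) : Prop :=
  [/\ bijective f, zmod_morphism f, monoid_morphism f & forall a, f (j a) = j a].

Record gal := Gal { gal_fun :> Fs -> Fs; gal_funP : `[< is_aut gal_fun >] }.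

HB.instance Definition _ := [isSub for gal_fun].
HB.instance Definition _ := [Choice of gal by <:].

Lemma galP (f : gal) : is_aut f.
Proof. exact/asboolP/(gal_funP f). Qed.

Lemma is_aut_id : is_aut id.
Proof. by split=> //; exists id. Qed.

Lemma is_aut_comp f g : is_aut f -> is_aut g -> is_aut (f \o g).
Proof.
move=> [fb fB [f1 fM] fj] [gb gB [g1 gM] gj]; split.
- exact: bij_comp.
- by move=> x y /=; rewrite gB fB.
- by split=> [|x y] /=; [rewrite g1 f1|rewrite gM fM].
- by move=> a /=; rewrite gj fj.
Qed.

Lemma is_aut_inv f g : is_aut f -> cancel f g -> cancel g f -> is_aut g.
Proof.
move=> [fb fB [f1 fM] fj] fK gK; split.
- by exists f.
- by move=> x y; apply: (can_inj fK); rewrite fB !gK.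
- by split=> [|x y]; apply: (can_inj fK); rewrite ?fM !gK.
- by move=> a; apply: (can_inj fK); rewrite gK fj.
Qed.

Definition gal_one : gal := Gal (asboolT is_aut_id).

Definition gal_mul (f g : gal) : gal :=
  Gal (asboolT (is_aut_comp (galP f) (galP g))).

Lemma gal_inv_exists (f : gal) : exists g : gal, cancel f g /\ cancel g f.
Proof.
have [[g fK gK] _ _ _] := galP f.
by exists (Gal (asboolT (is_aut_inv (galP f) fK gK))).
Qed.

Definition gal_inv (f : gal) : gal := projT1 (cid (gal_inv_exists f)).

Lemma gal_mulA : associative gal_mul.
Proof. by move=> f g h; apply: val_inj. Qed.

Lemma gal_mul1 : left_id gal_one gal_mul.
Proof. by move=> f; apply: val_inj. Qed.

Lemma gal_mul_1 : right_id gal_one gal_mul.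
Proof. by move=> f; apply: val_inj. Qed.

Lemma gal_mulV : left_inverse gal_one gal_inv gal_mul.
Proof.
move=> f; apply: val_inj; apply/funext => x /=.
by rewrite /gal_inv; case: cid => g [].
Qed.

Lemma gal_mul_V : right_inverse gal_one gal_inv gal_mul.
Proof.
move=> f; apply: val_inj; apply/funext => x /=.
by rewrite /gal_inv; case: cid => g [].
Qed.

HB.instance Definition _ :=
  isGroup.Build gal gal_mulA gal_mul1 gal_mul_1 gal_mulV gal_mul_V.

Lemma gal_mulE (f g : gal) x : (f * g)%g x = f (g x).
Proof. by []. Qed.

End AbsoluteGalois.

Section GaloisCohomology.
Variables (F Fs : fieldType) (j : {rmorphism F -> Fs}) (R : comNzRingType).
Local Notation G := (gal j).

(* Continuity for the Krull topology on G, the product topology on G^n and the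
   discrete topology on R: a basis of neighbourhoods of s in G is given by the
   sets {t | t = s on L}, for L a finite subset of Fs. *)
Definition krull_continuous n (f : cochain G R n) : Prop :=
  forall s : 'I_n -> G, exists L : seq Fs, forall t : 'I_n -> G,
    (forall i x, x \in L -> t i x = s i x) -> f t = f s.

Definition cocycle_pred n : {pred cochain G R n} :=
  fun f => `[< krull_continuous f /\ coboundary f = 0 >].

Lemma krull_continuousB n (f g : cochain G R n) :
  krull_continuous f -> krull_continuous g -> krull_continuous (f - g).
Proof.
move=> fc gc s; have [L fL] := fc s; have [M gM] := gc s.
exists (L ++ M) => t ts; rewrite -![(f - g) _]/(f _ - g _) fL ?gM //;
  by move=> i x xL; apply: ts; rewrite mem_cat xL ?orbT.
Qed.

Lemma krull_continuous_cup m n (f : cochain G R m) (g : cochain G R n) :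
  krull_continuous f -> krull_continuous g -> krull_continuous (cup f g).
Proof.
move=> fc gc s; have [L fL] := fc (fun i => s (lshift n i)).
have [M gM] := gc (fun i => s (rshift m i)).
exists (L ++ M) => t ts; rewrite /cup (fL (fun i => t (lshift n i))) ?gM //;
  by move=> i x xL; apply: ts; rewrite mem_cat xL ?orbT.
Qed.

Lemma cocycle_zmod_closed n : zmod_closed (@cocycle_pred n).
Proof.
split=> [|f g /asboolP[fc f0] /asboolP[gc g0]]; apply/asboolP; split.
- by move=> s; exists [::].
- exact: raddf0.
- exact: krull_continuousB.
- by rewrite raddfB /= f0 g0 subrr.
Qed.

HB.instance Definition _ n :=
  GRing.isZmodClosed.Build (cochain G R n) (@cocycle_pred n)
    (@cocycle_zmod_closed n).

Record cocycle n := Cocycle {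
  cocycle_val :> cochain G R n;
  cocycle_valP : cocycle_val \in @cocycle_pred n
}.

HB.instance Definition _ n := [isSub for @cocycle_val n].
HB.instance Definition _ n := [Choice of cocycle n by <:].
HB.instance Definition _ n := [SubChoice_isSubZmodule of cocycle n by <:].

Lemma cocycleP n (f : cocycle n) : krull_continuous f /\ coboundary f = 0.
Proof. exact/asboolP/(cocycle_valP f). Qed.

Definition is_coboundary n : cochain G R n -> Prop :=
  match n with
  | 0 => fun f => f = 0
  | m.+1 => fun f => exists2 h : cochain G R m, krull_continuous h & f = coboundary h
  end.

Definition coboundary_pred n : {pred cocycle n} := fun f => `[< is_coboundary f >].

Lemma coboundary_zmod_closed n : zmod_closed (@coboundary_pred n).
Proof.
split=> [|f g /asboolP Bf /asboolP Bg]; apply/asboolP.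
  case: n => [//|n] /=; exists 0; last by rewrite raddf0.
  by move=> s; exists [::].
rewrite -[cocycle_val (f - g)]/(cocycle_val f - cocycle_val g).
case: n f g Bf Bg => [|n] f g /= => [-> ->|]; first by rewrite subrr.
move=> [h hc ->] [h' hc' ->]; exists (h - h'); last by rewrite raddfB.
exact: krull_continuousB.
Qed.

HB.instance Definition _ n :=
  GRing.isZmodClosed.Build (cocycle n) (@coboundary_pred n)
    (@coboundary_zmod_closed n).

Definition galois_cohomology n : zmodType := Quotient.quot (@coboundary_pred n).
Local Notation H := galois_cohomology.

Definition cohomology_class n (f : cocycle n) : H n := \pi_(H n) f.

Lemma cohomology_classP n (f g : cocycle n) :
  cohomology_class f = cohomology_class g <->
  is_coboundary (cocycle_val f - cocycle_val g).
Proof.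
split.
  by move=> /eqP; rewrite -Quotient.idealrBE => /asboolP.
by move=> B; apply/eqP; rewrite -Quotient.idealrBE; apply/asboolP.
Qed.

Lemma cup_cocycle m n (f : cocycle m) (g : cocycle n) :
  cup f g \in @cocycle_pred (m + n).
Proof.
have [fc f0] := cocycleP f; have [gc g0] := cocycleP g.
apply/asboolP; split; first exact: krull_continuous_cup.
by apply/funext => s; rewrite coboundary_cup /cup f0 g0 mulr0 mulr0 mul0r addr0.
Qed.

Definition cocycle_cup m n (f : cocycle m) (g : cocycle n) : cocycle (m + n) :=
  Cocycle (cup_cocycle f g).

(* Defined on representatives; see [cohomology_cup_class]. *)
Definition cohomology_cup m n (a : H m) (b : H n) : H (m + n) :=
  cohomology_class (cocycle_cup (repr a) (repr b)).

Lemma is_coboundary_cast m n (e : n.+1 = m) (f : cochain G R m) h :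
  krull_continuous h -> f = (fun s => coboundary h (fun i => s (cast_ord e i))) ->
  is_coboundary f.
Proof.
move=> hc; case: m / e f => f -> /=; exists h => //.
by apply/funext => s; congr coboundary; apply/funext => i; rewrite cast_ord_id.
Qed.

Lemma cohomology_cup_class m n (f : cocycle m) (g : cocycle n) :
  cohomology_cup (cohomology_class f) (cohomology_class g) =
  cohomology_class (cocycle_cup f g).
Proof.
rewrite /cohomology_cup.
have := reprK (cohomology_class f); have := reprK (cohomology_class g).
set f' := repr (cohomology_class f); set g' := repr (cohomology_class g).
move=> /cohomology_classP Bg /cohomology_classP Bf.
transitivity (cohomology_class (cocycle_cup f' g)).
  apply/cohomology_classP; rewrite /=.
  have [f'c f'0] := cocycleP f'.
  have -> : cup f' g' - cup f' g = cup f' (cocycle_val g' - cocycle_val g).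
    by apply/funext => s; rewrite -![(_ - _) _]/(_ s - _ s) /cup -mulrBr.
  move: (_ - _) Bg; case: {g g'} n => [|n] g /=.
    move=> ->; have -> : cup f' (0 : cochain G R 0) = 0.
      by apply/funext => s; rewrite /cup mulr0.
    by have [/asboolP] := coboundary_zmod_closed (m + 0).
  move=> [h hc ->].
  pose h' : cochain G R (m + n) := fun s => (-1) ^+ m * cup f' h s.
  have hc' : krull_continuous h'.
    move=> s; have [L cL] := krull_continuous_cup f'c hc s.
    by exists L => t /cL; rewrite /h' => ->.
  apply: (is_coboundary_cast (e := esym (addnS m n)) hc').
  apply/funext => s; set s' : 'I_(m + n).+1 -> G := fun i => s (cast_ord _ i).
  have -> : coboundary h' s' = (-1) ^+ m * coboundary (cup f' h) s'.
    by rewrite /coboundary mulr_sumr; apply: eq_bigr => i _; rewrite mulrCA.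
  rewrite coboundary_cup f'0 /cup mul0r add0r mulrA -expr2 sqrr_sign mul1r.
  congr (cocycle_val f' _ * coboundary h _); apply/funext => i;
    by rewrite /s'; congr s; apply: val_inj.
apply/cohomology_classP; rewrite /=.
have [gc g0] := cocycleP g.
have -> : cup f' g - cup f g = cup (cocycle_val f' - cocycle_val f) g.
  by apply/funext => s; rewrite -![(_ - _) _]/(_ s - _ s) /cup -mulrBl.
move: (_ - _) Bf; clear Bg; clearbody f'; case: m f f' => [|m] f f' h /=.
  move=> ->; have -> : cup (0 : cochain G R 0) g = 0.
    by apply/funext => s; rewrite /cup mul0r.
  by have [/asboolP] := coboundary_zmod_closed (0 + n).
move=> [{}h hc ->]; exists (cup h g); first exact: krull_continuous_cup.
by apply/funext => s; rewrite coboundary_cup g0 mulr0 mulr0 addr0.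
Qed.

End GaloisCohomology.

(* For char F <> 2 the Galois modules mu_2 = {1, -1} and mu_2^{(x) n} are
   canonically Z/2 with trivial action, so that H^n(F, mu_2^{(x) n}) is
   [galois_cohomology j 'F_2 n], the pairing mu_2^{(x) m} (x) mu_2^{(x) n} ->
   mu_2^{(x) (m + n)} being the product of 'F_2. *)
Section Symbols.
Variables (F Fs : fieldType) (j : {rmorphism F -> Fs}).
Local Notation G := (gal j).

Definition sqrt_in_closure (a : F) : Fs :=
  xget 0 [set z : Fs | z ^+ 2 = j a]%classic.

(* s |-> s(sqrt a) / sqrt a, with {1, -1} written additively. *)
Definition kummer_cochain (a : F) : cochain G 'F_2 1 :=
  fun s => (s ord0 (sqrt_in_closure a) != sqrt_in_closure a)%:R.

Lemma gal_sqrt_in_closure (a : F) (s : G) :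
  s (sqrt_in_closure a) = sqrt_in_closure a \/
  s (sqrt_in_closure a) = - sqrt_in_closure a.
Proof.
have [_ sB [s1 sM] sj] := galP s; rewrite /sqrt_in_closure.
case: xgetP => [z _ /= zE|_]; last first.
  by left; rewrite -[X in s X](subrr 0) sB subrr.
have : (s z) ^+ 2 == z ^+ 2 by rewrite expr2 -sM -expr2 zE sj.
by rewrite eqf_sqr => /orP[] /eqP; [left|right].
Qed.

Lemma kummer_cocycle_subproof (a : F) :
  kummer_cochain a \in @cocycle_pred _ _ j 'F_2 1.
Proof.
apply/asboolP; split.
  move=> s; exists [:: sqrt_in_closure a] => t ts.
  by rewrite /kummer_cochain ts ?mem_head.
apply/funext => s; rewrite /coboundary !big_ord_recl big_ord0 /= /bump /=.
rewrite /face /kummer_cochain /=.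
set s0 := s (lift _ _); set s1 := s (widen_ord _ _).
have sN (x : Fs) (t : G) : t (- x) = - t x.
  have [_ tB _ _] := galP t.
  by rewrite -sub0r tB -[X in t X](subrr 0) tB subrr sub0r.
have [->|e0] := gal_sqrt_in_closure a s0; have [e1|e1] := gal_sqrt_in_closure a s1;
  rewrite ?e0 ?sN ?e1 ?opprK ?eqxx; 
  case: (- sqrt_in_closure a == sqrt_in_closure a); exact/val_inj.
Qed.

Definition kummer_cocycle (a : F) : cocycle j 'F_2 1 :=
  Cocycle (kummer_cocycle_subproof a).

Definition square_class (a : F) : galois_cohomology j 'F_2 1 :=
  cohomology_class (kummer_cocycle a).

Lemma cochain0_1_subproof :
  (fun _ => 1) \in @cocycle_pred _ _ j 'F_2 0.
Proof.
apply/asboolP; split; first by move=> s; exists [::].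
by apply/funext => s; rewrite /coboundary !big_ord_recl big_ord0; apply/val_inj.
Qed.

Definition cohomology_one : galois_cohomology j 'F_2 0 :=
  cohomology_class (Cocycle cochain0_1_subproof).

Fixpoint symbol n : ('I_n -> F) -> galois_cohomology j 'F_2 n :=
  match n with
  | 0 => fun _ => cohomology_one
  | m.+1 => fun a =>
      cohomology_cup (square_class (a ord0)) (symbol (fun i => a (lift ord0 i)))
  end.

End Symbols.

(* The curves E_i : y_i^2 = x_i (x_i - 1) (x_i - lam_i), for i < n, and their
   product; in k[x, y] the variables are x_0, ..., x_(n-1), y_0, ..., y_(n-1). *)
Section LegendreProduct.
Variables (k : fieldType) (n : nat) (lam : 'I_n -> k).

Definition legendre_x (i : 'I_n) : {mpoly k[n + n]} := 'X_(lshift n i).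
Definition legendre_y (i : 'I_n) : {mpoly k[n + n]} := 'X_(rshift n i).

Definition legendre_eq (i : 'I_n) : {mpoly k[n + n]} :=
  legendre_y i ^+ 2 -
  legendre_x i * (legendre_x i - 1) * (legendre_x i - (lam i)%:MP).

(* [K], with the values of the coordinate functions given by [coord], is the
   function field of the product of the E_i: the fraction field of the
   coordinate ring k[x, y] / (legendre_eq i)_i of the affine open subset
   obtained by removing the points at infinity of the E_i. *)
Record legendre_function_field (K : fieldType) := LegendreFunctionField {
  coord :> {rmorphism {mpoly k[n + n]} -> K};
  coord_ker : forall p, coord p = 0 <->
    exists c : 'I_n -> {mpoly k[n + n]}, p = \sum_i c i * legendre_eq i;
  coord_frac : forall z, exists p q, coord q != 0 /\ z = coord p / coord q
}.

End LegendreProduct.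

(* Main.v *)
(* Let [O] be a valuation ring of the separable closure extending [v0] for which
   every [x_i] is infinitesimal with respect to the positive values of [k], the
   [x_i] having independent values.  Since [y_i^2 = - x_i^2 u] with [u] in
   [1 + m], adjoining the [y_i] to [k(x)] does not change values or residues.
   Take a maximal subfield [N] of the separable closure, containing [k(x)], in
   which every element has an odd power of the form [c x^a (1 + m)].  Maximality
   makes [N] henselian with algebraically closed residue field and no extension
   of odd degree, so its Galois group is pro-2 and acts through the tame
   characters [s |-> s z / z] mod [m]: it is abelian.  As no nontrivial product
   of the [sqrt x_i] lies in [N], there are commuting [g_1, ..., g_n] over [k(Y)]
   whose Kummer matrix on [x_1, ..., x_n] is invertible over [F_2].  Evaluating a
   cocycle on the shuffle cycle [\sum_s [g_(s 1) | ... | g_(s n)]] kills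
   coboundaries and sends the symbol to the determinant of that matrix. *)

Require Import Defs.
From HB Require Import structures.
From mathcomp Require Import all_boot all_order all_fingroup all_solvable all_algebra separable.
From mathcomp Require Import boolp classical_sets functions.
From mathcomp Require Import mpoly ring.

Set Implicit Arguments.
Unset Strict Implicit.
Unset Printing Implicit Defensive.

Import Order.TTheory GRing.Theory Num.Theory.

Local Open Scope ring_scope.

(** * Subfields and separable closures *)

(** On [E_i] the divisor of [x_i] is twice a difference of two points, so a valuation of [k(Y)] that
    is trivial on [k] gives [x_i] a value divisible by 2 and cannot detect the symbol. This obstacle
    forces a valuation that is nontrivial on [k]. Modulo positive values [E_i] degenerates to the
    nodal cubic [y^2 = x^2 (x - 1)], whose branches at the node are parametrised by [x], so there
    [x_i] can keep a value that is not even. Concretely the unit [u] is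
    [(1 - x_i) (1 - lam_i / x_i)], and [lam_i / x_i] is infinitesimal because [lam_i] has positive
    value. Maximality of [N] stands in for ramification theory: henselising, closing the residue
    field and absorbing odd-degree extensions all keep elements almost monomial, so a single use of
    Zorn's lemma provides them together. Since the group left over is pro-2 and 2 is a unit of [O],
    it has no wild part; this is what makes the tame characters faithful. Coefficients in [F_2] make
    the signs of the shuffles disappear, so that evaluation of the symbol is the Leibniz formula
    itself. *)

Lemma zorn_above (T : Type) (P : set (set T)) (A0 : set T) : P A0 ->
  (forall F : set (set T), (F !=set0)%classic -> (forall X, F X -> P X) ->
     total_on F subset -> P (\bigcup_(X in F) X)%classic) ->
  exists A, [/\ (A0 `<=` A)%classic, P A &
    forall B, (A `<=` B)%classic -> P B -> (B `<=` A)%classic].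
Proof.
move=> PA0 Pchain.
have [|A [PA Amax]] := @Zorn_bigcup T (fun X => P (A0 `|` X)%classic).
  (* Zorn's lemma is applied to the sets [X] with [P (A0]|[X)]. The empty chain then has [A0] itself
     as upper bound, which is why the chain hypothesis may be restricted to nonempty [F]. *)
  move=> F FP Ftot; have [F0|/set0P[X0 FX0]] := eqVneq F set0%classic.
    by rewrite F0 bigcup_set0 setU0.
  have -> : (A0 `|` \bigcup_(X in F) X =
      \bigcup_(Y in [set (A0 `|` X) | X in F]) Y)%classic.
    apply/seteqP; split=> [x [A0x|[X FX Xx]]|x [_ [X FX <-]] [A0x|Xx]].
    - by exists (A0 `|` X0)%classic; [exists X0|left].
    - by exists (A0 `|` X)%classic; [exists X|right].
    - by left.
    - by right; exists X.
  apply: Pchain.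
  - by exists (A0 `|` X0)%classic, X0.
  - by move=> _ [X FX <-]; exact: FP.
  - move=> _ _ [X FX <-] [Y FY <-].
    by have [XY|YX] := Ftot _ _ FX FY; [left|right]; exact: setUS.
exists (A0 `|` A)%classic; split=> // B AB PB.
have BE : (A0 `|` B = B)%classic.
  by apply/setUidPr => x A0x; apply: AB; left.
have [BA|nBA] := pselect (B `<=` A)%classic; first by move=> x /BA; right.
exfalso; apply: (Amax B); last by rewrite BE.
by split=> // x Ax; apply: AB; right.
Qed.

Lemma subring_of_set (R : pzRingType) (A : set R) : A 1 ->
  (forall x y, A x -> A y -> A (x - y)) ->
  (forall x y, A x -> A y -> A (x * y)) ->
  exists S : subringClosed R, forall x, (x \in S) <-> A x.
Proof.
move=> A1 AB AM; pose S : {pred R} := fun x => `[< A x >].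
have Sc : subring_closed S.
  split=> [|x y|x y]; rewrite /in_mem /=; first exact/asboolP.
  - by move=> /asboolP ? /asboolP ?; apply/asboolP/AB.
  - by move=> /asboolP ? /asboolP ?; apply/asboolP/AM.
pose m := GRing.isSubringClosed.Build R S Sc.
pose T : subringClosed R := HB.pack S m.
by exists T => x; split=> /asboolP.
Qed.

Lemma subfield_of_set (K : fieldType) (A : set K) : A 1 ->
  (forall x y, A x -> A y -> A (x - y)) ->
  (forall x y, A x -> A y -> A (x * y)) ->
  (forall x, A x -> A x^-1) ->
  exists N : divringClosed K, forall x, (x \in N) <-> A x.
Proof.
move=> A1 AB AM AV; pose S : {pred K} := fun x => `[< A x >].
have Sc : GRing.divring_closed S.
  split=> [|x y|x y]; rewrite /in_mem /=; first exact/asboolP.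
  - by move=> /asboolP ? /asboolP ?; apply/asboolP/AB.
  - by move=> /asboolP ? /asboolP ?; apply/asboolP/AM => //; exact: AV.
pose m := GRing.isDivringClosed.Build K S Sc.
pose T : divringClosed K := HB.pack S m.
by exists T => x; split=> /asboolP.
Qed.

Section SubfieldType.
Variables (K : fieldType) (N : divringClosed K).

Record subfield_type := SubfieldType {
  subfield_val :> K;
  subfield_valP : subfield_val \in N
}.

HB.instance Definition _ := [isSub for subfield_val].
HB.instance Definition _ := [Choice of subfield_type by <:].
HB.instance Definition _ := [SubChoice_isSubComNzRing of subfield_type by <:].
HB.instance Definition _ := [SubNzRing_isSubUnitRing of subfield_type by <:].
HB.instance Definition _ :=
  [SubComUnitRing_isSubIntegralDomain of subfield_type by <:].
HB.instance Definition _ := [SubIntegralDomain_isSubField of subfield_type by <:].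

Lemma polyOver_subfield (p : {poly K}) : p \is a polyOver N ->
  exists P : {poly subfield_type}, map_poly val P = p.
Proof.
move=> /polyOverP pN.
exists (\poly_(i < size p) SubfieldType (pN i)); apply/polyP => i.
rewrite coef_map coef_poly; case: ltnP => // ip.
by rewrite raddf0 nth_default.
Qed.

End SubfieldType.

Lemma finite_roots (K : fieldType) (p : {poly K}) : p != 0 ->
  exists s : seq K, forall x, root p x -> x \in s.
Proof.
move: {2}(size p) (leqnn (size p)) => n; elim: n p => [|n IH] p.
  by rewrite leqn0 size_poly_eq0 => /eqP ->; rewrite eqxx.
move=> pn p0; have [[x xp]|nx] := pselect (exists x, root p x); last first.
  by exists [::] => x xp; case: nx; exists x.
have /factor_theorem[q pE] := xp.
have q0 : q != 0 by apply: contraNneq p0 => q0; rewrite pE q0 mul0r.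
have [|//|s sq] := IH q.
  by move: pn; rewrite pE size_mul ?polyXsubC_eq0 // size_XsubC addn2.
exists (x :: s) => y; rewrite pE rootM root_XsubC in_cons orbC.
by case/orP => [->//|/sq ->]; rewrite orbT.
Qed.

Section ExtendRoot.
Variables (D Fs : fieldType) (iota phi : {rmorphism D -> Fs}).
Hypothesis Fs_sep :
  forall p : {poly Fs}, separable_poly p -> (1 < size p)%N -> exists z, root p z.

Lemma min_annihilator (w : Fs) (P : {poly D}) : P != 0 ->
  root (map_poly iota P) w ->
  exists Q : {poly D}, [/\ Q != 0, root (map_poly iota Q) w &
    forall G, root (map_poly iota G) w -> Q %| G].
Proof.
move=> P0 Pw.
pose good n := `[< exists Q : {poly D},
  [/\ Q != 0, root (map_poly iota Q) w & size Q = n] >].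
have ex_good : exists n, good n by exists (size P); apply/asboolP; exists P.
case: (ex_minnP ex_good) => m /asboolP[Q [Q0 Qw Qm]] mmin.
exists Q; split=> // G Gw; rewrite /dvdp; apply: contraT => GQ.
have : (m <= size (G %% Q)%R)%N.
  apply: mmin; apply/asboolP; exists (G %% Q); split=> //.
  have: root (map_poly iota (G %/ Q * Q + G %% Q)) w by rewrite -divp_eq.
  by rewrite rmorphD rmorphM /root !hornerE (eqP Qw) mulr0 add0r.
by rewrite -Qm leqNgt ltn_modpN0.
Qed.

(** One step of extending [phi] to [D[w]]: the minimal annihilator of [w] divides [P], so its
    transport along [phi] is separable and has a root, and every [G] killing [w] is a multiple of
    it. *)
Lemma extend_root (w : Fs) (P : {poly D}) : separable_poly P ->
  root (map_poly iota P) w ->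
  exists w', forall G, root (map_poly iota G) w -> root (map_poly phi G) w'.
Proof.
move=> sP Pw; have [Q [Q0 Qw Qmin]] := min_annihilator (separable_poly_neq0 sP) Pw.
have sQ : separable_poly Q := dvdp_separable (Qmin _ Pw) sP.
have Q1 : (1 < size (map_poly phi Q))%N.
  rewrite size_map_poly -(size_map_poly iota).
  by apply: root_size_gt1 Qw; rewrite map_poly_eq0.
have [|w' w'Q] := Fs_sep _ Q1; first by rewrite separable_map.
exists w' => G /Qmin /(dvdpP _ _)[H ->].
by rewrite rmorphM /= rootM w'Q orbT.
Qed.

(** For [w] outside [D] the minimal annihilator has degree at least 2. Dividing out ['X - w] leaves
    a nonconstant separable factor, and by separability [w] is not one of its roots. *)
Lemma conjugate_root (w : Fs) (P : {poly D}) : separable_poly P ->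
  root (map_poly iota P) w -> (forall a, iota a != w) ->
  exists2 w', w' != w &
    forall G, root (map_poly iota G) w -> root (map_poly iota G) w'.
Proof.
move=> sP Pw wD.
have [Q [Q0 Qw Qmin]] := min_annihilator (separable_poly_neq0 sP) Pw.
have sQ : separable_poly Q := dvdp_separable (Qmin _ Pw) sP.
have /factor_theorem[R QE] := Qw.
have R0 : R != 0.
  by apply: contraNneq Q0 => R0; rewrite -(map_poly_eq0 iota) QE R0 mul0r.
have R1 : (1 < size R)%N.
  rewrite ltnNge; apply/negP => R1.
  have Q2 : (size Q <= 2)%N.
    by rewrite -(size_map_poly iota) QE size_mul ?polyXsubC_eq0 // size_XsubC addn2.
  have Q10 : Q`_1 != 0.
    have Qgt1 : (1 < size Q)%N.
      rewrite -(size_map_poly iota); apply: root_size_gt1 Qw.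
      by rewrite map_poly_eq0.
    have sizeQ : size Q = 2%N by apply/eqP; rewrite eqn_leq Q2 Qgt1.
    by move: Q0; rewrite -lead_coef_eq0 lead_coefE sizeQ.
  have := wD (- Q`_0 / Q`_1); rewrite fmorph_div rmorphN => /eqP; apply.
  move: Qw; rewrite /root horner_coef size_map_poly => /eqP.
  have /= := horner_coef_wide w (_ : (size (map_poly iota Q) <= 2)%N).
  rewrite size_map_poly => /(_ Q2); rewrite horner_coef size_map_poly => ->.
  rewrite !big_ord_recl big_ord0 /= addr0 expr0 mulr1 /bump /= addn0 expr1 !coef_map.
  move=> /eqP; rewrite addr_eq0 => /eqP ->; rewrite opprK mulrAC divff ?mul1r //.
  by rewrite fmorph_eq0.
have /Fs_sep/(_ R1) : separable_poly R.
  apply: (@dvdp_separable _ (map_poly iota Q)); last by rewrite separable_map.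
  by rewrite QE dvdp_mulr.
case=> w' Rw'; exists w'.
  apply: contraTneq sQ => ww'.
  by rewrite -(separable_map iota) QE separable_root -ww' Rw' andbF.
move=> G /Qmin /(dvdpP _ _)[H ->]; rewrite rmorphM /= rootM; apply/orP; right.
by rewrite QE rootM Rw'.
Qed.

End ExtendRoot.

Section GaloisAutomorphisms.
Variables (F Fs : fieldType) (j : {rmorphism F -> Fs}).

Lemma gal_zmod_morphism (s : gal j) : zmod_morphism s.
Proof. by have [] := galP s. Qed.

Lemma gal_monoid_morphism (s : gal j) : monoid_morphism s.
Proof. by have [] := galP s. Qed.

HB.instance Definition _ (s : gal j) :=
  GRing.isZmodMorphism.Build Fs Fs s (gal_zmod_morphism s).
HB.instance Definition _ (s : gal j) :=
  GRing.isMonoidMorphism.Build Fs Fs s (gal_monoid_morphism s).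

Lemma gal_base (s : gal j) a : s (j a) = j a.
Proof. by have [] := galP s. Qed.

Lemma gal1E x : (1%g : gal j) x = x.
Proof. by []. Qed.

Lemma galVK (s : gal j) : cancel s (s^-1)%g.
Proof. by move=> x; rewrite -gal_mulE mulVg. Qed.

Lemma galKV (s : gal j) : cancel (s^-1)%g s.
Proof. by move=> x; rewrite -gal_mulE mulgV. Qed.

Lemma gal_inj (s : gal j) : injective s.
Proof. exact: can_inj (galVK s). Qed.

Lemma gal_ext (s t : gal j) : (forall x, s x = t x) -> s = t.
Proof. by move=> st; apply: val_inj; apply/funext. Qed.

Hypothesis sep : is_separable_closure j.

Lemma sep_root (z : Fs) :
  exists2 p : {poly F}, separable_poly p & root (map_poly j p) z.
Proof. by case: sep. Qed.

(** The minimal annihilator of [a] has nonzero constant term, so the relation it gives can be solved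
    for [a^-1]. Hence any subring containing the base field is a field, and no fraction fields have
    to be formed inside [Fs]. *)
Lemma algebraic_inv (a : Fs) : a != 0 ->
  exists G : {poly F}, a^-1 = (map_poly j G).[a].
Proof.
move=> a0; have [p /separable_poly_neq0 p0 pa] := sep_root a.
have [Q [Q0 Qa Qmin]] := min_annihilator p0 pa.
have [q QE] : exists q : {poly F}, Q = q * 'X + (Q`_0)%:P.
  elim/poly_ind: Q {Q0 Qa Qmin} => [|q c _]; first by exists 0; rewrite mul0r coefC eqxx add0r.
  by exists q; rewrite coefD coefMX coefC eqxx add0r.
have Q00 : Q`_0 != 0.
  apply/eqP => Q00; have : root (map_poly j q) a.
    move: Qa; rewrite QE Q00 addr0 rmorphM /= map_polyX rootM => /orP[//|].
    by rewrite /root hornerX (negPf a0).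
  move=> /Qmin; have q0 : q != 0.
    by apply: contraNneq Q0 => q0; rewrite QE Q00 q0 mul0r addr0.
  move=> /dvdp_leq => /(_ q0); rewrite QE Q00 addr0 size_mulX //.
  by rewrite ltnn.
exists (- (Q`_0)^-1 *: q); rewrite map_polyZ hornerZ rmorphN fmorphV mulNr.
move: Qa; rewrite QE rmorphD rmorphM /= map_polyX map_polyC /root !hornerE.
rewrite coefD coefMX coefC eqxx add0r addr_eq0 => /eqP qa.
apply: (mulfI a0); rewrite mulfV // mulrN mulrCA [a * _]mulrC qa mulrN opprK.
by rewrite mulVf // fmorph_eq0.
Qed.

Lemma subring_algebraic_inv (A : subringClosed Fs) : (forall a, j a \in A) ->
  forall a, a \in A -> a^-1 \in A.
Proof.
move=> jA a aA; have [->|a0] := eqVneq a 0; first by rewrite invr0 rpred0.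
have [G ->] := algebraic_inv a0; apply: rpred_horner aA.
by apply/polyOverP => i; rewrite coef_map; exact: jA.
Qed.

Lemma subfield_sep_root (N : divringClosed Fs) : (forall a, j a \in N) ->
  forall z, exists2 P : {poly subfield_type N},
    separable_poly P & root (map_poly val P) z.
Proof.
move=> jN z; have [p sp pz] := sep_root z.
have [|P PE] := @polyOver_subfield _ N (map_poly j p).
  by apply/polyOverP => i; rewrite coef_map; exact: jN.
by exists P; [rewrite -(separable_map val) PE separable_map|rewrite PE].
Qed.

(** An injective endomorphism over [F] permutes the finitely many roots of any nonzero polynomial
    over [F]. *)
Lemma endo_bijective (s : {rmorphism Fs -> Fs}) : (forall a, s (j a) = j a) ->
  bijective s.
Proof.
move=> sj; have s_surj y : exists x, s x = y.
  have [p /separable_poly_neq0 p0 py] := sep_root y.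
  have [|c0 c0P] := @finite_roots _ (map_poly j p); first by rewrite map_poly_eq0.
  pose c := undup [seq x <- c0 | root (map_poly j p) x].
  have cP x : (x \in c) = root (map_poly j p) x.
    by rewrite mem_undup mem_filter; case: (boolP (root _ x)) => // /c0P.
  have sc : {subset map s c <= c}.
    move=> _ /mapP[x xc ->]; rewrite cP; move: xc; rewrite cP /root => /eqP px.
    have -> : map_poly j p = map_poly s (map_poly j p).
      by apply/polyP => i; rewrite !coef_map /= sj.
    by rewrite horner_map px rmorph0.
  have uc : uniq (map s c) by rewrite map_inj_uniq ?undup_uniq //; exact: fmorph_inj.
  have [_ /(_ y)] := uniq_min_size uc sc (eq_leq (esym (size_map s c))).
  by rewrite cP py => /mapP[x _ ->]; exists x.
exists (fun y => projT1 (cid (s_surj y))) => x; case: cid => y //=.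
exact: fmorph_inj.
Qed.

(* Zorn's lemma on partial homomorphisms, seen as subrings of [Fs * Fs]. *)
Lemma gal_moves (N : divringClosed Fs) z : (forall a, j a \in N) -> z \notin N ->
  exists2 s : gal j, (forall x, x \in N -> s x = x) & s z != z.
Proof.
move=> jN zN; have [_ Fs_root] := sep.
(* Graphs of ring homomorphisms over [N]. The clause on [(0, b)] is single-valuedness, since graphs
   are closed under differences. *)
pose homset (R : set (Fs * Fs)) := [/\ R (1, 1),
  (forall p q, R p -> R q -> R (p - q)), (forall p q, R p -> R q -> R (p * q)),
  (forall b, R (0, b) -> b = 0) & (forall a, a \in N -> R (a, a))].
pose evals (D : fieldType) (iota phi : {rmorphism D -> Fs}) w w' :=
  [set p : Fs * Fs |
    exists G : {poly D}, p = ((map_poly iota G).[w], (map_poly phi G).[w'])]%classic.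
have evals_hom (D : fieldType) (iota phi : {rmorphism D -> Fs}) w w' :
    (forall G, root (map_poly iota G) w -> root (map_poly phi G) w') ->
    (forall a, a \in N -> exists2 d, iota d = a & phi d = a) ->
    homset (evals D iota phi w w').
  move=> ww' Nd; split.
  - by exists 1; rewrite !rmorph1 !hornerE.
  - by move=> _ _ [G ->] [H ->]; exists (G - H); rewrite !rmorphB !hornerE.
  - by move=> _ _ [G ->] [H ->]; exists (G * H); rewrite !rmorphM !hornerE.
  - by move=> b [G [/esym/eqP Gw ->]]; apply/eqP/ww'.
  - by move=> a /Nd[d da da']; exists d%:P; rewrite !map_polyC /= !hornerE da da'.
have [P sP Pz] := subfield_sep_root jN z.
have [|z' z'z zz'] := conjugate_root Fs_root sP Pz.
  by move=> a; apply: contraNneq zN => <-; exact: valP.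
have [||R [R0R [R1 RB RM Rinj RN] Rmax]] :=
  @zorn_above _ homset (evals (subfield_type N) val val z z').
- by apply: evals_hom => // a aN; exists (SubfieldType aN).
- move=> S [X0 SX0] Shom Stot.
  have dir p q : (\bigcup_(X in S) X)%classic p -> (\bigcup_(X in S) X)%classic q ->
      exists X, [/\ S X, X p & X q].
    move=> [X SX Xp] [Y SY Yq]; have [XY|YX] := Stot _ _ SX SY.
      by exists Y; split=> //; exact: XY.
    by exists X; split=> //; exact: YX.
  split.
  - by exists X0 => //; case: (Shom _ SX0).
  - move=> p q Xp /(dir _ _ Xp)[X [SX {}Xp Xq]]; exists X => //.
    by case: (Shom _ SX) => _ + _ _ _; apply.
  - move=> p q Xp /(dir _ _ Xp)[X [SX {}Xp Xq]]; exists X => //.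
    by case: (Shom _ SX) => _ _ + _ _; apply.
  - by move=> b [X SX Xb]; case: (Shom _ SX) => _ _ _ + _; apply.
  - by move=> a aN; exists X0 => //; case: (Shom _ SX0) => _ _ _ _; apply.
have Rzz' : R (z, z').
  by apply: R0R; exists 'X; rewrite !map_polyX !hornerX.
have R00 : R (0, 0) by rewrite -[(0, 0)]/(0 : Fs * Fs) -(subrr (1, 1)); exact: RB.
have Runiq a b b' : R (a, b) -> R (a, b') -> b = b'.
  move=> ab ab'; apply/eqP; rewrite -subr_eq0; apply/eqP/Rinj.
  by have := RB _ _ ab ab'; rewrite -[_ - _]/(a - a, b - b') subrr.
have [D0 D0P] : exists D0 : subringClosed Fs, forall a, a \in D0 <-> exists b, R (a, b).
  apply: (@subring_of_set _ (fun a => exists b, R (a, b))).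
  - by exists 1.
  - by move=> x y [b xb] [c yc]; exists (b - c); exact: (RB _ _ xb yc).
  - by move=> x y [b xb] [c yc]; exists (b * c); exact: (RM _ _ xb yc).
have [D DP] : exists D : divringClosed Fs, forall a, a \in D <-> exists b, R (a, b).
  apply: subfield_of_set.
  - by exists 1.
  - by move=> x y [b xb] [c yc]; exists (b - c); exact: (RB _ _ xb yc).
  - by move=> x y [b xb] [c yc]; exists (b * c); exact: (RM _ _ xb yc).
  - move=> x /D0P xD; apply/D0P/subring_algebraic_inv => // a.
    by apply/D0P; exists (j a); exact: RN.
pose phi (d : subfield_type D) : Fs := xget 0 (fun b => R (val d, b)).
have phiP d : R (val d, phi d).
  rewrite /phi; case: xgetP => [b _ //|nb].
  by have /DP[b] := valP d => /nb.
have phiB : zmod_morphism phi.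
  move=> a b; apply: (@Runiq (val (a - b))); first exact: phiP.
  by rewrite rmorphB; exact: (RB _ _ (phiP a) (phiP b)).
have phiM : monoid_morphism phi.
  split; first by apply: (@Runiq 1) => //; have := phiP 1; rewrite rmorph1.
  move=> a b; apply: (@Runiq (val (a * b))); first exact: phiP.
  by rewrite rmorphM; exact: (RM _ _ (phiP a) (phiP b)).
pose phib := GRing.isZmodMorphism.Build _ _ phi phiB.
pose phim := GRing.isMonoidMorphism.Build _ _ phi phiM.
pose phiH : {rmorphism subfield_type D -> Fs} := HB.pack phi phib phim.
have NsubD a : a \in N -> a \in D by move=> aN; apply/DP; exists a; exact: RN.
(* The domain [D] is a field, so any [w] can be adjoined by sending it to a root of its transported
   annihilator; by maximality it was already in the domain. *)
have Rtot w : exists w', R (w, w').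
  have [Q sQ Qw] := subfield_sep_root (fun a => NsubD _ (jN a)) w.
  have [w' ww'] := extend_root phiH Fs_root sQ Qw.
  exists w'; apply: (Rmax (evals (subfield_type D) val phiH w w')).
  - move=> [a b] Rab; have aD : a \in D by apply/DP; exists b.
    exists (SubfieldType aD)%:P; rewrite !map_polyC !hornerC /=; congr (_, _).
    by apply: (Runiq _ _ _ Rab); exact: (phiP (SubfieldType aD)).
  - apply: evals_hom => // a aN; exists (SubfieldType (NsubD _ aN)) => //=.
    by apply: (@Runiq a); [exact: (phiP (SubfieldType (NsubD _ aN)))|exact: RN].
  - by exists 'X; rewrite !map_polyX !hornerX.
pose s w := projT1 (cid (Rtot w)).
have sR w : R (w, s w) by rewrite /s; case: cid.
have sB : zmod_morphism s.
  by move=> a b; apply: (Runiq _ _ _ (sR _)); exact: (RB _ _ (sR a) (sR b)).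
have sM : monoid_morphism s.
  split; first by apply: (Runiq _ _ _ (sR _)).
  by move=> a b; apply: (Runiq _ _ _ (sR _)); exact: (RM _ _ (sR a) (sR b)).
have sN x : x \in N -> s x = x by move=> xN; apply: (Runiq _ _ _ (sR _)); exact: RN.
pose sb := GRing.isZmodMorphism.Build _ _ s sB.
pose sm := GRing.isMonoidMorphism.Build _ _ s sM.
pose sH : {rmorphism Fs -> Fs} := HB.pack s sb sm.
have saut : is_aut j s.
  split=> //; last by move=> a; exact: sN.
  by apply: (@endo_bijective sH) => a; exact: sN.
exists (Gal (asboolT saut)) => //=.
by rewrite (Runiq _ _ _ (sR z) Rzz').
Qed.

End GaloisAutomorphisms.

(** * Valuation rings *)

Lemma subf_div (K : fieldType) (a t b u : K) : t != 0 -> u != 0 ->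
  a / t - b / u = (a * u - b * t) / (t * u).
Proof. by move=> t0 u0; rewrite -mulNr addf_div // mulNr. Qed.

Record valring (K : fieldType) := Valring {
  valring_pred :> subringClosed K;
  valring_total : forall z : K, z \in valring_pred \/ z^-1 \in valring_pred
}.

Section ValuationRing.
Variables (K : fieldType) (O : valring K).

Definition vmax : {pred K} := fun z => (z == 0) || (z^-1 \notin O).

Lemma vmaxE z : (z \in vmax) = (z == 0) || (z^-1 \notin O).
Proof. by []. Qed.

Lemma vmaxW z : z \in vmax -> z \in O.
Proof.
rewrite vmaxE => /orP[/eqP ->|zV]; first exact: rpred0.
by case: (valring_total O z) zV => [//|->].
Qed.

Lemma vmaxMl a z : a \in O -> z \in vmax -> a * z \in vmax.
Proof.
move=> aO; rewrite !vmaxE; have [->|z0] := eqVneq z 0; first by rewrite mulr0 eqxx.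
have [->|a0] := eqVneq a 0; first by rewrite mul0r eqxx.
move=> /= zV; rewrite mulf_eq0 (negPf a0) (negPf z0) /=.
apply: contra zV => azV; have -> : z^-1 = a * (a * z)^-1.
  by rewrite invfM mulrA mulfV // mul1r.
exact: rpredM.
Qed.

Lemma vmaxMr a z : a \in O -> z \in vmax -> z * a \in vmax.
Proof. by move=> aO zm; rewrite mulrC vmaxMl. Qed.

Lemma vmax1 : 1 \notin vmax.
Proof. by rewrite vmaxE oner_eq0 invr1 negbK rpred1. Qed.

Lemma vmax_zmod : zmod_closed vmax.
Proof.
split=> [|x y xm ym]; first by rewrite vmaxE eqxx.
have [y0|y0] := eqVneq y 0; first by rewrite y0 subr0.
have [x0|x0] := eqVneq x 0.
  by rewrite x0 sub0r -mulN1r vmaxMl // rpredN rpred1.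
have [xyO|yxO] := valring_total O (x / y).
  have -> : x - y = (x / y - 1) * y by rewrite mulrBl mul1r divfK.
  by rewrite vmaxMl // rpredB ?rpred1.
have -> : x - y = (1 - (x / y)^-1) * x by rewrite invf_div mulrBl mul1r divfK.
by rewrite vmaxMl // rpredB ?rpred1.
Qed.

HB.instance Definition _ := GRing.isZmodClosed.Build K vmax vmax_zmod.

Definition vunit : {pred K} := fun z => [&& z != 0, z \in O & z^-1 \in O].

Lemma vunit_divr : divr_closed vunit.
Proof.
split; first by rewrite /in_mem /= /vunit oner_eq0 invr1 rpred1.
move=> x y /and3P[x0 xO xV] /and3P[y0 yO yV]; apply/and3P; split.
- by rewrite mulf_neq0 ?invr_eq0.
- exact: rpredM.
- by rewrite invf_div rpredM.
Qed.

HB.instance Definition _ := GRing.isDivClosed.Build K vunit vunit_divr.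

Lemma vunitP z : reflect [/\ z != 0, z \in O & z^-1 \in O] (z \in vunit).
Proof. exact: and3P. Qed.

Lemma vunit_neq0 z : z \in vunit -> z != 0.
Proof. by case/vunitP. Qed.

Lemma vunitE z : (z \in vunit) = (z \in O) && (z \notin vmax).
Proof.
rewrite vmaxE negb_or negbK; apply/vunitP/and3P; last by case.
by case.
Qed.

Lemma vmax_vunit z : z \in vmax -> z \notin vunit.
Proof. by move=> zm; rewrite vunitE zm andbF. Qed.

Lemma nvmaxV z : z \notin vmax -> z^-1 \in O.
Proof. by rewrite vmaxE negb_or negbK => /andP[]. Qed.

Lemma nvalringV z : z \notin O -> z^-1 \in vmax.
Proof. by move=> zO; rewrite vmaxE invrK zO orbT. Qed.

(** Primality of the maximal ideal, used to single out a factor of a split polynomial. *)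
Lemma vmax_prod (I : Type) (s : seq I) (f : I -> K) :
  (forall i, f i \notin vmax) -> \prod_(i <- s) f i \notin vmax.
Proof.
move=> fm; apply/negP => pm; have p0 : \prod_(i <- s) f i != 0.
  elim/big_ind: _ => [|x y x0 y0|i _]; first exact: oner_neq0.
    by rewrite mulf_neq0.
  by apply: contraNneq (fm i) => ->; exact: rpred0.
move: pm; rewrite vmaxE (negPf p0) /= => /negP; apply.
by rewrite -prodfV; apply: rpred_prod => i _; exact: nvmaxV.
Qed.

(** The group [1 + m]. The relation [x / y \in vone] means that [x] and [y] have the same leading
    term; as [0^-1 = 0] and 0 is not in [1 + m], it also forces both to be nonzero. *)
Definition vone : {pred K} := fun z => z - 1 \in vmax.

Lemma voneE z : (z \in vone) = (z - 1 \in vmax). Proof. by []. Qed.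

Lemma vone_unit z : z \in vone -> z \in vunit.
Proof.
rewrite voneE vunitE => zm; have -> : z = (z - 1) + 1 by rewrite subrK.
rewrite rpredD ?rpred1 ?vmaxW //=.
by apply: contra vmax1 => z1m; have := rpredB z1m zm; rewrite addrC addKr.
Qed.

Lemma vone_divr : divr_closed vone.
Proof.
split; first by rewrite voneE subrr rpred0.
move=> x y xm ym; have [y0 yO yV] := vunitP _ (vone_unit ym).
have -> : x / y = 1 + (x - y) / y by rewrite mulrBl mulfV // addrC subrK.
rewrite voneE addrC addKr vmaxMr //.
by have := rpredB xm ym; rewrite opprB addrA subrK.
Qed.

HB.instance Definition _ := GRing.isDivClosed.Build K vone vone_divr.

Lemma vone_neq0 z : z \in vone -> z != 0.
Proof. by move=> /vone_unit/vunit_neq0. Qed.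

Lemma vone_div_neq0 x y : x / y \in vone -> x != 0 /\ y != 0.
Proof.
by move=> /vone_neq0; rewrite mulf_eq0 invr_eq0 negb_or => /andP[].
Qed.

Lemma vone_sym x y : x / y \in vone -> y / x \in vone.
Proof. by move=> xy; rewrite -invf_div rpredV. Qed.

Lemma vone_trans y x z : x / y \in vone -> y / z \in vone -> x / z \in vone.
Proof.
move=> xy yz; have [_ y0] := vone_div_neq0 xy.
by have := rpredM xy yz; rewrite mulrA divfK.
Qed.

Lemma voneM x y x' y' : x / y \in vone -> x' / y' \in vone -> (x * x') / (y * y') \in vone.
Proof. by move=> xy xy'; rewrite invfM mulrACA rpredM. Qed.

Lemma voneX n x y : x / y \in vone -> x ^+ n / y ^+ n \in vone.
Proof. by move=> xy; rewrite -expr_div_n rpredX. Qed.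

Lemma vone_sub x y : y != 0 -> (x - y) / y \in vmax -> x / y \in vone.
Proof. by move=> y0; rewrite mulrBl mulfV. Qed.

Lemma seq_vmin (c : seq K) w : w \in c -> 0 \notin c ->
  exists2 u, u \in c & forall v, v \in c -> v / u \in O.
Proof.
elim: c w => [//|x c IH] w _; rewrite in_cons negb_or eq_sym => /andP[x0 c0].
case: c c0 IH => [_ _|y c c0 IH].
  by exists x; rewrite ?mem_head // => v; rewrite inE => /eqP ->; rewrite mulfV // rpred1.
have [u uc umin] := IH y (mem_head _ _) c0.
have u0 : u != 0 by apply: contraNneq c0 => <-.
have [xu|ux] := valring_total O (x / u).
  exists u; first by rewrite in_cons uc orbT.
  by move=> v; rewrite in_cons => /orP[/eqP -> //|/umin].
exists x; first exact: mem_head.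
move=> v; rewrite in_cons => /orP[/eqP ->|/umin vu]; first by rewrite mulfV ?rpred1.
have -> : v / x = (v / u) * (x / u)^-1 by field; rewrite x0 u0.
exact: rpredM.
Qed.

End ValuationRing.

Section Chevalley.
Variables (K : fieldType).

Lemma zmod_of_set (I : set K) : I 0 -> (forall x y, I x -> I y -> I (x - y)) ->
  exists S : zmodClosed K, forall x, (x \in S) <-> I x.
Proof.
move=> I0 IB; pose S : {pred K} := fun x => `[< I x >].
have Sc : zmod_closed S.
  split=> [|x y]; rewrite /in_mem /=; first exact/asboolP.
  by move=> /asboolP ? /asboolP ?; apply/asboolP/IB.
pose m := GRing.isZmodClosed.Build K S Sc.
pose T : zmodClosed K := HB.pack S m.
by exists T => x; split=> /asboolP.
Qed.

Definition proper_ideal (A I : set K) := [/\ [/\ A 1,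
  (forall x y, A x -> A y -> A (x - y)) & (forall x y, A x -> A y -> A (x * y))],
  (I `<=` A)%classic, I 0, (forall x y, I x -> I y -> I (x - y)) &
  (forall a x, A a -> I x -> I (a * x)) /\ ~ I 1].

(* Chevalley's extension theorem: a maximal pair (subring, proper ideal). *)
Lemma valring_exists (U V : set K) : proper_ideal U V ->
  exists O : valring K, (forall x, U x -> x \in O) /\ (forall x, V x -> x \in vmax O).
Proof.
(* The boolean tag packs the ring ([true]) and the ideal ([false]) into one set, so that Zorn's
   lemma for inclusion applies to pairs. *)
move=> UVp; pose X0 := [set p : K * bool | if p.2 then U p.1 else V p.1]%classic.
pose good (X : set (K * bool)) :=
  proper_ideal (fun a => X (a, true)) (fun a => X (a, false)).
have [||X [X0X [[A1 AB AM] IA I0 IB [IM I1]] Xmax]] := @zorn_above _ good X0.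
- exact: UVp.
- move=> S [Y0 SY0] Sgood Stot.
  have dir p q : (\bigcup_(X in S) X)%classic p -> (\bigcup_(X in S) X)%classic q ->
      exists X, [/\ S X, X p & X q].
    move=> [X SX Xp] [Y SY Yq]; have [XY|YX] := Stot _ _ SX SY.
      by exists Y; split=> //; exact: XY.
    by exists X; split=> //; exact: YX.
  split.
  + split; first by exists Y0 => //; case: (Sgood _ SY0) => -[].
    * move=> x y Xx /(dir _ _ Xx)[X [SX {}Xx Xy]]; exists X => //.
      by case: (Sgood _ SX) => -[_ AB _] _ _ _ _; exact: AB.
    * move=> x y Xx /(dir _ _ Xx)[X [SX {}Xx Xy]]; exists X => //.
      by case: (Sgood _ SX) => -[_ _ AM] _ _ _ _; exact: AM.
  + by move=> x [X SX Xx]; exists X => //; case: (Sgood _ SX) => _ IA _ _ _; exact: IA.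
  + by exists Y0 => //; case: (Sgood _ SY0).
  + move=> x y Xx /(dir _ _ Xx)[X [SX {}Xx Xy]]; exists X => //.
    by case: (Sgood _ SX) => _ _ _ IB _; exact: IB.
  + split; last by move=> [X SX X1]; case: (Sgood _ SX) => _ _ _ _ [_]; apply.
    move=> a x Xa /(dir _ _ Xa)[X [SX {}Xa Xx]]; exists X => //.
    by case: (Sgood _ SX) => _ _ _ _ [IM _]; exact: IM.
have [A AP] := subring_of_set A1 AB AM; have [I IP] := zmod_of_set I0 IB.
have max_pair (B J : set K) : (forall x, x \in A -> B x) -> (forall x, x \in I -> J x) ->
    proper_ideal B J -> forall x, B x -> x \in A.
  move=> AB' IJ' BJ x Bx; apply/AP.
  apply: (Xmax [set p : K * bool | if p.2 then B p.1 else J p.1]%classic).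
  - by move=> [a []] /= Xa; [apply/AB'/AP|apply/IJ'/IP].
  - exact: BJ.
  - by [].
have IsubA x : x \in I -> x \in A by move=> /IP/IA/AP.
have AMI a x : a \in A -> x \in I -> a * x \in I.
  by move=> /AP aA /IP xI; apply/IP/IM.
have nI1 : 1 \notin I by apply/negP => /IP.
(* Localising at [1 + I] keeps the ideal proper, so by maximality the elements of [1 + I] are
   already invertible in [A]. *)
have inv1 s : 1 - s \in I -> s != 0 /\ s^-1 \in A.
  move=> sI; pose T x := 1 - x \in I.
  have T0 x : T x -> x != 0.
    by move=> Tx; apply: contraNneq nI1 => x0; move: Tx; rewrite /T x0 subr0.
  have TA x : T x -> x \in A.
    by move=> /IsubA xA; rewrite -(subKr 1 x) rpredB ?rpred1.
  have TM x y : T x -> T y -> T (x * y).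
    move=> Tx Ty; rewrite /T; have -> : 1 - x * y = (1 - x) + x * (1 - y).
      by rewrite mulrBr mulr1 addrA subrK.
    by rewrite rpredD // AMI // TA.
  have T1 : T 1 by rewrite /T subrr rpred0.
  split; first exact: T0.
  apply: (max_pair [set x | exists a t, [/\ a \in A, T t & x = a / t]]%classic
                   [set x | exists a t, [/\ a \in I, T t & x = a / t]]%classic).
  - by move=> x xA; exists x, 1; rewrite invr1 mulr1.
  - by move=> x xI; exists x, 1; rewrite invr1 mulr1.
  - split.
    + split; first by exists 1, 1; rewrite invr1 mulr1; split=> //; exact: rpred1.
        move=> _ _ [a [t [aA Tt ->]]] [b [u [bA Tu ->]]].
        exists (a * u - b * t), (t * u); split; last exact: subf_div (T0 _ Tt) (T0 _ Tu).
          by rewrite rpredB // rpredM // TA.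
        exact: TM.
      move=> _ _ [a [t [aA Tt ->]]] [b [u [bA Tu ->]]].
      by exists (a * b), (t * u); split; [exact: rpredM|exact: TM|rewrite mulf_div].
    + by move=> _ [a [t [aI Tt ->]]]; exists a, t; split=> //; exact: IsubA.
    + by exists 0, 1; rewrite invr1 mulr1; split=> //; exact: rpred0.
    + move=> _ _ [a [t [aA Tt ->]]] [b [u [bA Tu ->]]].
      exists (a * u - b * t), (t * u); split; last exact: subf_div (T0 _ Tt) (T0 _ Tu).
        by rewrite rpredB // mulrC AMI // TA.
      exact: TM.
    + split.
        move=> _ _ [a [t [aA Tt ->]]] [b [u [bI Tu ->]]].
        by exists (a * b), (t * u); split; [exact: AMI|exact: TM|rewrite mulf_div].
      move=> [a [t [aI Tt E]]]; have /negP := nI1; apply.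
      have at' : a = t by rewrite -[t]mul1r E divfK // T0.
      by have := rpredD Tt aI; rewrite at' subrK.
  - by exists 1, s; rewrite mul1r; split=> //; exact: rpred1.
(* By maximality [I[z]] cannot be a proper ideal of [A[z]]. *)
have ext_one z : z \notin A -> exists2 P, P \is a polyOver I & P.[z] = 1.
  move=> zA; apply: contrapT => nP; move/negP: zA; apply.
  have polyAM P Q : P \is a polyOver A -> Q \is a polyOver I -> P * Q \is a polyOver I.
    move=> /polyOverP PA /polyOverP QI; apply/polyOverP => i; rewrite coefM.
    by apply: rpred_sum => k _; exact: AMI.
  apply: (max_pair [set x | exists2 P, P \is a polyOver A & P.[z] = x]%classic
                   [set x | exists2 P, P \is a polyOver I & P.[z] = x]%classic).
  - by move=> x xA; exists x%:P; [rewrite polyOverC|rewrite hornerC].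
  - by move=> x xI; exists x%:P; [rewrite polyOverC|rewrite hornerC].
  - split.
    + split; first by exists 1; [exact: rpred1|rewrite hornerC].
        by move=> _ _ [P PA <-] [Q QA <-]; exists (P - Q); [exact: rpredB|rewrite !hornerE].
      by move=> _ _ [P PA <-] [Q QA <-]; exists (P * Q); [exact: rpredM|rewrite !hornerE].
    + move=> _ [P /polyOverP PI <-]; exists P => //.
      by apply/polyOverP => i; exact: IsubA.
    + by exists 0; [exact: rpred0|rewrite horner0].
    + by move=> _ _ [P PA <-] [Q QA <-]; exists (P - Q); [exact: rpredB|rewrite !hornerE].
    + split; last by move=> [P PI P1]; apply: nP; exists P.
      by move=> _ _ [P PA <-] [Q QA <-]; exists (P * Q); [exact: polyAM|rewrite !hornerE].
  - by exists 'X; [exact: polyOverX|rewrite hornerX].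
(* The relation [Q.[z^-1] = 1] writes the unit [1 - Q_0] through positive powers of [z^-1].
   Multiplying by the top term of [P] trades that term for terms of lower degree, still with
   coefficients in [I]. *)
have reduce z (P Q : {poly K}) : z != 0 -> P \is a polyOver I -> Q \is a polyOver I ->
    P.[z] = 1 -> Q.[z^-1] = 1 -> (size Q <= size P)%N ->
    exists P', [/\ P' \is a polyOver I, P'.[z] = 1 & (size P' < size P)%N].
  move=> z0 /polyOverP PI /polyOverP QI Pz Qz QP.
  have [s0 sV] : 1 - Q`_0 != 0 /\ (1 - Q`_0)^-1 \in A by apply: inv1; rewrite subKr.
  set s := 1 - Q`_0 in s0 sV.
  have Q0 : (0 < size Q)%N.
    rewrite lt0n size_poly_eq0; apply: contra_eq_neq Qz => ->.
    by rewrite horner0 eq_sym oner_eq0.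
  have P0 : (0 < size P)%N by exact: leq_trans QP.
  have Qz' : \sum_(i < (size Q).-1) Q`_i.+1 * z^-1 ^+ i.+1 = s.
    move: Qz; rewrite horner_coef /s; case: (size Q) Q0 => [//|q] _ /=.
    by rewrite big_ord_recl expr0 mulr1 => <-; rewrite addrC addKr.
  pose Plow := \poly_(i < (size P).-1) P`_i.
  pose R := \sum_(i < (size Q).-1) (s^-1 * Q`_i.+1) *: 'X^((size P).-1 - i.+1).
  exists (Plow + lead_coef P *: R); split.
  - apply: rpredD.
      apply/polyOverP => i; rewrite coef_poly; case: ifP => _; [exact: PI|exact: rpred0].
    apply/polyOverP => i; rewrite coefZ coef_sum mulr_sumr; apply: rpred_sum => k _.
    rewrite coefZ coefXn lead_coefE; case: eqP => _; last by rewrite !mulr0 rpred0.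
    by rewrite mulr1 AMI ?AMI //; exact: IsubA.
  - rewrite hornerD hornerZ horner_sum -[RHS]Pz.
    have -> : P.[z] =
        \sum_(i < (size P).-1) P`_i * z ^+ i + lead_coef P * z ^+ (size P).-1.
      rewrite horner_coef lead_coefE; case: (size P) P0 => [//|p] _ /=.
      by rewrite big_ord_recr.
    congr (_ + _ * _); first by rewrite horner_poly.
    rewrite -[RHS]mul1r -(mulVf s0) -[X in _ = _ * X * _]Qz' mulr_sumr mulr_suml.
    apply: eq_bigr => i _; rewrite hornerZ hornerXn -!mulrA; congr (_ * (_ * _)).
    have iP : (i.+1 <= (size P).-1)%N.
      by apply: (leq_trans (ltn_ord i)); rewrite -!subn1 leq_sub2r.
    by rewrite -{2}(subnK iP) exprD mulrCA -exprMn mulVf // expr1n mulr1.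
  - rewrite -[X in (_ < X)%N](prednK P0) ltnS.
    rewrite (leq_trans (size_polyD _ _)) // geq_max size_poly.
    rewrite (leq_trans (size_scale_leq _ _)) // (leq_trans (size_sum _ _ _)) //.
    apply/bigmax_leqP => i _; rewrite (leq_trans (size_scale_leq _ _)) // size_polyXn.
    have iP : (i.+1 <= (size P).-1)%N.
      by apply: (leq_trans (ltn_ord i)); rewrite -!subn1 leq_sub2r.
    by rewrite -subSn // subSS leq_subr.
(* Descent on the total size; exchanging [z] and [z^-1] always lets the longer polynomial be
   shortened. *)
have no_pair n z (P Q : {poly K}) : (size P + size Q <= n)%N -> z != 0 ->
    P \is a polyOver I -> Q \is a polyOver I -> P.[z] = 1 -> Q.[z^-1] = 1 -> False.
  elim: n z P Q => [|n IH] z P Q sPQ z0 PI QI Pz Qz.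
    move: sPQ; rewrite leqn0 addn_eq0 => /andP[]; rewrite size_poly_eq0 => /eqP P0 _.
    by move: Pz; rewrite P0 horner0 => /eqP; rewrite eq_sym oner_eq0.
  have [QP|PQ] := leqP (size Q) (size P).
    have [P' [P'I P'z P'P]] := reduce z P Q z0 PI QI Pz Qz QP.
    apply: (IH z P' Q) => //; rewrite -ltnS (leq_trans _ sPQ) //.
    by rewrite ltn_add2r.
  have zV0 : z^-1 != 0 by rewrite invr_eq0.
  have [|Q' [Q'I Q'z Q'Q]] := reduce z^-1 Q P zV0 QI PI Qz _ (ltnW PQ).
    by rewrite invrK.
  apply: (IH z P Q') => //; rewrite -ltnS (leq_trans _ sPQ) //.
  by rewrite ltn_add2l.
have Atot z : z \in A \/ z^-1 \in A.
  have [z0|z0] := eqVneq z 0; first by left; rewrite z0 rpred0.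
  apply/orP; apply: contraT; rewrite negb_or => /andP[/ext_one[P PI Pz] /ext_one[Q QI Qz]].
  by case: (no_pair _ z P Q (leqnn _)).
exists (Valring Atot); split=> [x Ux|x Vx]; first by apply/AP; exact: (X0X (x, true)).
have xI : x \in I by apply/IP; exact: (X0X (x, false)).
rewrite vmaxE; have [//|x0 /=] := eqVneq x 0.
by apply: contra nI1 => xV; rewrite -(mulVf x0) AMI.
Qed.

End Chevalley.

(** * Galois orbits *)

Section Orbits.
Variables (F Fs : fieldType) (j : {rmorphism F -> Fs}).
Hypothesis sep : is_separable_closure j.
Variable N : divringClosed Fs.
Hypothesis jN : forall a, j a \in N.

Definition fixes (s : gal j) := forall x, x \in N -> s x = x.

Lemma fixes1 : fixes 1%g.
Proof. by []. Qed.

Lemma fixesM s t : fixes s -> fixes t -> fixes (s * t)%g.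
Proof. by move=> sN tN x xN; rewrite gal_mulE tN // sN. Qed.

Lemma fixesV s : fixes s -> fixes (s^-1)%g.
Proof. by move=> sN x xN; rewrite -{1}(sN x xN) galVK. Qed.

Lemma fixed_in z : (forall s, fixes s -> s z = z) -> z \in N.
Proof.
move=> zfix; apply: contraT => /(gal_moves sep jN)[s sN].
by rewrite zfix ?eqxx.
Qed.

Lemma orbit_exists z : exists c : seq Fs, uniq c /\
  forall w, w \in c <-> exists2 s, fixes s & w = s z.
Proof.
have [p sp pz] := sep_root sep z.
have [|c cP] := @finite_roots _ (map_poly j p).
  by rewrite map_poly_eq0 separable_poly_neq0.
pose conj w := `[< exists2 s, fixes s & w = s z >].
exists (undup [seq w <- c | conj w]); split=> [|w]; first exact: undup_uniq.
rewrite mem_undup mem_filter; split=> [/andP[/asboolP//]|[s sN wE]].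
apply/andP; split; first by apply/asboolP; exists s.
apply: cP; rewrite wE; move: pz; rewrite /root => /eqP pz.
have -> : map_poly j p = map_poly s (map_poly j p).
  by apply/polyP => i; rewrite !coef_map /= gal_base.
by rewrite horner_map pz rmorph0.
Qed.

Definition orb z : seq Fs := projT1 (cid (orbit_exists z)).

Lemma orb_uniq z : uniq (orb z).
Proof. by rewrite /orb; case: cid => c []. Qed.

Lemma orbP z w : w \in orb z <-> exists2 s, fixes s & w = s z.
Proof. by rewrite /orb; case: cid => c []. Qed.

Lemma orb_id z : z \in orb z.
Proof. by apply/orbP; exists 1%g; [exact: fixes1|]. Qed.

Lemma orb_stable z s w : fixes s -> w \in orb z -> s w \in orb z.
Proof.
by move=> sN /orbP[t tN ->]; apply/orbP; exists (s * t)%g; [exact: fixesM|].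
Qed.

Definition stable_seq (c : seq Fs) := forall s, fixes s -> perm_eq (map s c) c.

Lemma orb_perm z : stable_seq (orb z).
Proof.
move=> s sN; have us : uniq (map s (orb z)).
  by rewrite map_inj_uniq ?orb_uniq //; exact: gal_inj.
apply: uniq_perm => //; first exact: orb_uniq.
have sub : {subset map s (orb z) <= orb z}.
  by move=> _ /mapP[w wz ->]; exact: orb_stable.
by have [_] := uniq_min_size us sub (eq_leq (esym (size_map s (orb z)))).
Qed.

Lemma stable_prod_XsubC c : stable_seq c ->
  \prod_(w <- c) ('X - w%:P) \is a polyOver N.
Proof.
move=> cst; apply/polyOverP => i; apply: fixed_in => s sN.
rewrite -coef_map rmorph_prod /= (eq_bigr (fun w => 'X - (s w)%:P)); last first.
  by move=> w _; rewrite rmorphB /= map_polyX map_polyC.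
by rewrite -(big_map s xpredT (fun w => 'X - w%:P)) (perm_big _ (cst s sN)).
Qed.

Variable O : valring Fs.

(** The orbit sum of [y] is invariant, and [y] is its leading term because the other conjugates are
    infinitesimal relative to it. *)
Lemma dominant_sim y : y != 0 ->
  (forall s, fixes s -> s y = y \/ s y / y \in vmax O) ->
  exists2 a, a \in N & y / a \in vone O.
Proof.
move=> y0 ydom; exists (\sum_(w <- orb y) w).
  apply: fixed_in => s sN; rewrite rmorph_sum /=.
  by rewrite -(big_map s xpredT id) (perm_big _ (orb_perm y sN)).
apply: vone_sym; apply: vone_sub => //.
rewrite (bigD1_seq y) ?orb_id ?orb_uniq //= addrAC subrr add0r mulr_suml.
rewrite big_seq_cond; apply: rpred_sum => w /andP[/orbP[s sN ->] sy].
by have [syy|//] := ydom s sN; rewrite syy eqxx in sy.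
Qed.

Lemma vmax_prod_ratio (s t : seq Fs) : size s = size t -> (0 < size s)%N ->
  (forall v u, v \in s -> u \in t -> v / u \in vmax O) ->
  (\prod_(v <- s) v) / (\prod_(u <- t) u) \in vmax O.
Proof.
elim: s t => [//|v s IH] [//|u t] /= [st] _ vu; rewrite !big_cons invfM mulrACA.
have vum : v / u \in vmax O by apply: vu; rewrite mem_head.
case: s IH st vu => [|v' s] IH st vu.
  by case: t st {vu} => // _; rewrite !big_nil invr1 mulr1 mulr1.
apply: vmaxMl; first exact: vmaxW.
by apply: IH => // x y xs yt; apply: vu; rewrite in_cons ?xs ?yt orbT.
Qed.

(** If [s] does not preserve the part cut out by [p], it exchanges some of its members for equally
    many from the complement, each infinitesimal relative to every member of the part. *)
Lemma small_part_prod (c : seq Fs) (p : pred Fs) s :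
  (forall u v, u \in c -> v \in c -> p u -> ~~ p v -> v / u \in vmax O) ->
  0 \notin c -> stable_seq c -> fixes s ->
  let y := \prod_(u <- c | p u) u in
  (s y = y /\ forall u, u \in c -> p (s u) = p u) \/ s y / y \in vmax O.
Proof.
move=> pc c0 cst sN y; have perm_c := cst s sN.
have cs u : u \in c -> s u \in c.
  by move=> uc; rewrite -(perm_mem perm_c) map_f.
have yE : y = \prod_(u <- c | p (s u)) s u.
  by rewrite -(big_map s p id) (perm_big _ perm_c).
have syE : s y = \prod_(u <- c | p u) s u by rewrite rmorph_prod.
have cnt : count p c = count (fun u => p (s u)) c.
  by rewrite -(seq.permP perm_c) count_map.
(* The names refer to the source [u]: [bigs] lists the images that leave the part [p], [smalls]
   those that enter it. The ratio therefore has [bigs] in the numerator and is infinitesimal. *)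
pose bigs := [seq s u | u <- c & p u && ~~ p (s u)].
pose smalls := [seq s u | u <- c & p (s u) && ~~ p u].
have cntI (a b : pred Fs) : count a c =
    (count (fun u => a u && b u) c + count (fun u => a u && ~~ b u) c)%N.
  by elim: (c) => //= u d ->; case: (a u) (b u) => -[]; rewrite /= ?addnS.
have size_bs : size bigs = size smalls.
  rewrite !size_map !size_filter; apply/eqP; move: cnt.
  rewrite (cntI p (fun u => p (s u))) (cntI (fun u => p (s u)) p).
  rewrite (eq_count (_ : _ =1 (fun u => p (s u) && p u))) => [/addnI ->//|u].
  by rewrite andbC.
have ratio : s y / y = (\prod_(v <- bigs) v) / (\prod_(v <- smalls) v).
  rewrite !big_map !big_filter syE yE.
  rewrite (bigID (fun u => p (s u))) /=.
  rewrite [in X in _ / X](bigID p) /=.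
  rewrite (eq_bigl (fun u => p (s u) && p u)); last by move=> u; rewrite andbC.
  rewrite -mulf_div mulfV ?mul1r // big_seq_cond.
  elim/big_ind: _ => [|v w v0 w0|u /andP[uc _]]; first exact: oner_neq0.
    by rewrite mulf_neq0.
  by rewrite fmorph_eq0; apply: contraNneq c0 => <-.
have [b0|b0] := posnP (size bigs); [left|right]; last first.
  rewrite ratio; apply: vmax_prod_ratio => // v u /mapP[v' + ->] /mapP[u' + ->].
  rewrite !mem_filter => /andP[/andP[_ pv] vc] /andP[/andP[pu _] uc].
  by apply: pc => //; exact: cs.
have psE u : u \in c -> p (s u) = p u.
  have count0 (a : pred Fs) : count a c = 0%N -> u \in c -> ~~ a u.
    move=> ca uc; apply: contra_eqN ca => au; rewrite -lt0n -has_count.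
    by apply/hasP; exists u.
  move=> uc; have := b0; rewrite size_map size_filter => /count0/(_ uc) /= h1.
  have := b0; rewrite size_bs size_map size_filter => /count0/(_ uc) /= h2.
  by case: (p u) (p (s u)) h1 h2 => -[].
split=> //; rewrite syE [RHS]yE [LHS]big_seq_cond [RHS]big_seq_cond.
by apply: eq_bigl => u; case: (boolP (u \in c)) => //= uc; rewrite psE.
Qed.

End Orbits.

(** * Maximal almost monomial subfields *)

Section AlmostMonomial.
Variables (k : closedFieldType) (Fs : fieldType) (rho : {rmorphism k -> Fs}).
Variables (O : valring Fs) (T : set Fs).
Hypothesis T_neq0 : forall t, T t -> t != 0.
Hypothesis T_unit : forall t, T t -> t \in vunit O -> exists c, t = rho c.

(* Allowing an odd power makes the notion stable under extensions of odd degree,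
   while still preventing a product of distinct [x_i] from being a square. *)
Definition almost_monomial (z : Fs) :=
  z = 0 \/ exists d t, [/\ odd d, T t & z ^+ d / t \in vone O].
Local Notation E := almost_monomial.

Lemma almost_monomial_sim a z : E a -> z / a \in vone O -> E z.
Proof.
move=> Ea za; have [z0 a0] := vone_div_neq0 za.
case: Ea => [a0'|[d [t [dodd Tt at_]]]]; first by rewrite a0' eqxx in a0.
by right; exists d, t; split=> //; apply: vone_trans at_; exact: voneX.
Qed.

(** As [h] splits over [k], primality of the maximal ideal puts one factor [v - rho c] in it. *)
Lemma rho_root_mod (h : {poly k}) v : h \is monic ->
  (map_poly rho h).[v] \in vmax O -> exists c, v - rho c \in vmax O.
Proof.
move=> hm hv; have [r hE] := closed_field_poly_normal h.
apply: contrapT => nc; move: hv; rewrite hE (monicP hm) scale1r rmorph_prod /=.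
rewrite horner_prod => /negPn/negP; apply; apply: vmax_prod => c.
rewrite rmorphB /= map_polyX map_polyC !hornerE.
by apply/negP => vc; apply: nc; exists c.
Qed.

(** When [a] is a unit, so is the [t] with the leading term of [a ^+ d]; it is thus a constant [c],
    and [a] is a root of ['X^d - c] modulo the maximal ideal. *)
Lemma almost_monomial_residue a : E a -> a \in O -> exists c, a - rho c \in vmax O.
Proof.
move=> Ea aO; have [am|am] := boolP (a \in vmax O).
  by exists 0; rewrite rmorph0 subr0.
have au : a \in vunit O by rewrite vunitE aO am.
have [a0|[d [t [dodd Tt at1]]]] := Ea; first by rewrite a0 rpred0 in am.
have adu : a ^+ d \in vunit O by exact: rpredX.
have tu : t \in vunit O.
  have -> : t = a ^+ d / (a ^+ d / t).
    by rewrite invf_div mulrCA mulfV ?mulr1 // (vunit_neq0 adu).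
  by rewrite rpred_div // vone_unit.
have [c tE] := T_unit Tt tu.
apply: (@rho_root_mod ('X^d - c%:P)); first by apply: monicXnsubC; case: (d) dodd.
rewrite rmorphB /= map_polyXn map_polyC /= -tE !hornerE.
have -> : a ^+ d - t = (a ^+ d / t - 1) * t by rewrite mulrBl mul1r divfK // T_neq0.
by rewrite vmaxMr // ; case/vunitP: tu.
Qed.

Definition maximal_in (N : divringClosed Fs) :=
  (forall x, x \in N -> E x) /\
  (forall M : divringClosed Fs, (forall x, x \in N -> x \in M) ->
     (forall x, x \in M -> E x) -> forall x, x \in M -> x \in N).

Lemma maximal_subfield_exists (N0 : divringClosed Fs) : (forall x, x \in N0 -> E x) ->
  exists2 N : divringClosed Fs, (forall x, x \in N0 -> x \in N) & maximal_in N.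
Proof.
move=> N0E; pose good (A : set Fs) := [/\ A 1, (forall x y, A x -> A y -> A (x - y)),
  (forall x y, A x -> A y -> A (x * y)), (forall x, A x -> A x^-1) &
  (forall x, A x -> E x)].
have [||A [N0A [A1 AB AM AV AE] Amax]] := @zorn_above _ good (fun x => x \in N0).
- split=> [|x y xN yN|x y xN yN|x xN|//]; first exact: rpred1.
  + exact: rpredB.
  + exact: rpredM.
  + by rewrite rpredV.
- move=> S [Y0 SY0] Sgood Stot.
  have dir p q : (\bigcup_(X in S) X)%classic p -> (\bigcup_(X in S) X)%classic q ->
      exists X, [/\ S X, X p & X q].
    move=> [X SX Xp] [Y SY Yq]; have [XY|YX] := Stot _ _ SX SY.
      by exists Y; split=> //; exact: XY.
    by exists X; split=> //; exact: YX.
  split.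
  + by exists Y0 => //; case: (Sgood _ SY0).
  + move=> x y Xx /(dir _ _ Xx)[X [SX {}Xx Xy]]; exists X => //.
    by case: (Sgood _ SX) => _ AB _ _ _; exact: AB.
  + move=> x y Xx /(dir _ _ Xx)[X [SX {}Xx Xy]]; exists X => //.
    by case: (Sgood _ SX) => _ _ AM _ _; exact: AM.
  + by move=> x [X SX Xx]; exists X => //; case: (Sgood _ SX) => _ _ _ AV _; exact: AV.
  + by move=> x [X SX Xx]; case: (Sgood _ SX) => _ _ _ _; apply.
have [N NP] := subfield_of_set A1 AB AM AV; exists N; first by move=> x /N0A /NP.
split=> [x /NP /AE //|M NM ME x xM]; apply/NP.
apply: (Amax (fun x => x \in M)) xM => [y /NP /NM //|].
split=> [|y z yM zM|y z yM zM|y yM|//]; first exact: rpred1.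
- exact: rpredB.
- exact: rpredM.
- by rewrite rpredV.
Qed.

Hypothesis vmax2 : 2%:R \notin vmax O.

(** Hensel's lemma for square roots, by maximality: otherwise [N(r)] would be a larger field of
    almost monomial elements. Up to sign [r] is in [1 + m], and after dividing by [b] only the
    elements [a + r] matter. *)
Lemma maximal_sqrt (N : divringClosed Fs) r : maximal_in N ->
  r ^+ 2 \in N -> r ^+ 2 \in vone O -> r \in N.
Proof.
move=> [NE Nmax]; wlog r1 : r / r \in vone O.
  move=> wl r2N r21; have : (r - 1) * (r + 1) \in vmax O.
    by rewrite -subr_sqr expr1n.
  have [r1 _|r1] := boolP (r - 1 \in vmax O); first exact: wl.
  have [rN1 _|rN1] := boolP (r + 1 \in vmax O).
    rewrite -rpredN; apply: wl; rewrite ?sqrrN // voneE -opprD rpredN //.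
  move=> rr; exfalso; move/negP: rN1; apply.
  have r10 : r - 1 != 0 by apply: contraNneq r1 => ->; rewrite rpred0.
  by rewrite -(mulKf r10 (r + 1)) vmaxMl // nvmaxV.
move=> r2N _; have [//|rN] := boolP (r \in N).
have NrE a b : a \in N -> b \in N -> E (a + b * r).
  move=> aN bN; have [->|b0] := eqVneq b 0; first by rewrite mul0r addr0; exact: NE.
  have {}aN : a / b \in N by exact: rpred_div.
  have -> : a + b * r = b * (a / b + r) by rewrite mulrDr mulrCA mulfV // mulr1.
  move: (a / b) aN => {}a aN.
  have sim_b x y : x / y \in vone O -> b * x / (b * y) \in vone O.
    by rewrite -mulf_div mulfV // mul1r.
  (* If [a + 1] is infinitesimal, then [a + r] suffers cancellation but its conjugate [a - r] has
     leading term [-2], a unit; so [a + r] has the leading term of [(a^2 - r^2) / -2], an element of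
     [N]. Otherwise [a + r] has the leading term of [a + 1]. *)
  have [a1m|a1m] := boolP (a + 1 \in vmax O).
    have n20 : (- 2%:R : Fs) != 0.
      by rewrite oppr_eq0; apply: contraNneq vmax2 => ->; exact: rpred0.
    have arN : (a - r) / - 2%:R \in vone O.
      apply: vone_sub => //; apply: vmaxMr.
        rewrite invrN rpredN; exact: nvmaxV.
      have -> : a - r - - 2%:R = (a + 1) - (r - 1).
        by ring.
      exact: rpredB.
    have [ar0 _] := vone_div_neq0 arN.
    have ar2 : (a ^+ 2 - r ^+ 2) / - 2%:R \in N.
      by apply: rpred_div; [rewrite rpredB // rpredX|rewrite rpredN rpred_nat].
    apply: (almost_monomial_sim (NE _ (rpredM bN ar2))).
    apply: sim_b; have [ar'0|ar'0] := eqVneq (a + r) 0.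
      exfalso; move/negP: rN; apply; rewrite -(addKr a r) ar'0 addr0.
      by rewrite rpredN.
    have -> : (a + r) / ((a ^+ 2 - r ^+ 2) / - 2%:R) = ((a - r) / - 2%:R)^-1.
      by rewrite subr_sqr; field; rewrite n20 ar0 ar'0.
    by rewrite rpredV.
  apply: (almost_monomial_sim (NE _ (rpredM bN (rpredD aN (rpred1 N))))).
  apply: sim_b; apply: vone_sub; first by apply: contraNneq a1m => ->; exact: rpred0.
  have -> : a + r - (a + 1) = r - 1 by rewrite opprD addrACA subrr add0r.
  by apply: vmaxMr r1; exact: nvmaxV.
have [||||M MP] := @subfield_of_set _
  (fun x => exists a b, [/\ a \in N, b \in N & x = a + b * r]).
- by exists 1, 0; split; [exact: rpred1|exact: rpred0|rewrite mul0r addr0].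
- move=> _ _ [a [b [aN bN ->]]] [c [d [cN dN ->]]].
  by exists (a - c), (b - d); split; [exact: rpredB|exact: rpredB|ring].
- move=> _ _ [a [b [aN bN ->]]] [c [d [cN dN ->]]].
  exists (a * c + b * d * r ^+ 2), (a * d + b * c); split; last by ring.
    by apply: rpredD; [|apply: rpredM r2N]; exact: rpredM.
  by apply: rpredD; exact: rpredM.
- move=> _ [a [b [aN bN ->]]].
  pose n := a ^+ 2 - b ^+ 2 * r ^+ 2.
  have nN : n \in N by apply: rpredB; [|apply: rpredM r2N]; exact: rpredX.
  have n0 : n = (a + b * r) * (a - b * r) by rewrite /n; ring.
  have [n0'|n0'] := eqVneq n 0; last first.
    have : (a + b * r) != 0 /\ (a - b * r) != 0.
      by move: n0'; rewrite n0 mulf_eq0 negb_or => /andP[].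
    move=> [u0 v0]; exists (a / n), (- b / n); split.
    + exact: rpred_div.
    + by rewrite rpred_div // rpredN.
    + by rewrite n0; field; rewrite u0 v0.
  have b0 : b = 0.
    apply: contraNeq rN => b0; move/eqP: n0'; rewrite n0 mulf_eq0 => /orP[].
      rewrite addr_eq0 => /eqP abr; rewrite -(mulKf b0 r) -[b * r]opprK -abr.
      by rewrite rpredM ?rpredV // rpredN.
    by rewrite subr_eq0 => /eqP abr; rewrite -(mulKf b0 r) -abr rpredM ?rpredV.
  by exists a^-1, 0; split; [rewrite rpredV|exact: rpred0|rewrite b0 !mul0r !addr0].
suff rN' : r \in N by rewrite rN' in rN.
apply: (Nmax M) => [x xN||].
- by apply/MP; exists x, 0; split=> //; [exact: rpred0|rewrite mul0r addr0].
- by move=> x /MP[a [b [aN bN ->]]]; exact: NrE.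
- by apply/MP; exists 0, 1; split; [exact: rpred0|exact: rpred1|rewrite mul1r add0r].
Qed.

End AlmostMonomial.

(** * Triviality of wild automorphisms *)

Section TwoGroup.
Variables (F Fs : fieldType) (j : {rmorphism F -> Fs}).
Hypothesis sep : is_separable_closure j.
Variable N : divringClosed Fs.
Hypothesis jN : forall a, j a \in N.
Local Notation fixes := (@fixes F Fs j N).
(** Repetitions in the family are allowed, so that a family indexed by cosets qualifies even when
    different cosets give the same conjugate. *)
Hypothesis odd_orbit : forall z (l : seq (gal j)), odd (size l) ->
  (forall s, s \in l -> fixes s) ->
  stable_seq j N (map (fun s : gal j => s z) l) -> z \in N.

Section OneOrbit.
Variable c : seq Fs.
Hypothesis c_stable : forall s w, fixes s -> w \in c -> s w \in c.
Local Notation X := (seq_sub c).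

Definition induces (s : gal j) (p : {perm X}) :=
  fixes s /\ forall x : X, s (val x) = val (p x).

(** The order is reversed because permutations compose from left to right and automorphisms from
    right to left. *)
Lemma inducesM s t p q : induces s p -> induces t q -> induces (s * t)%g (q * p)%g.
Proof.
move=> [sN sp] [tN tq]; split; first exact: fixesM.
by move=> x; rewrite gal_mulE tq sp permM.
Qed.

Lemma induces1 : induces 1%g 1%g.
Proof. by split=> [|x]; [exact: fixes1|rewrite perm1]. Qed.

Lemma inducesX s p n : induces s p -> induces (s ^+ n)%g (p ^+ n)%g.
Proof.
move=> sp; elim: n => [|n IH]; first exact: induces1.
by rewrite expgSr [in X in induces _ X]expgS; exact: inducesM.
Qed.

Lemma inducesV s p : induces s p -> induces (s^-1)%g (p^-1)%g.
Proof.
move=> [sN sp]; split; first exact: fixesV.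
by move=> x; apply: (@gal_inj _ _ _ s); rewrite galKV sp permKV.
Qed.

Lemma induces_exists s : fixes s -> exists p, induces s p.
Proof.
move=> sN; pose f (x : X) : X := SeqSub (c_stable sN (valP x)).
have f_inj : injective f.
  by move=> x y /(congr1 val) /= /gal_inj/val_inj.
by exists (perm f_inj); split=> // x; rewrite permE.
Qed.

Definition induced_perms := [set p : {perm X} | `[< exists s, induces s p >]].

Lemma induced_permsP p : reflect (exists s, induces s p) (p \in induced_perms).
Proof. by rewrite inE; exact: asboolP. Qed.

Lemma induced_group_set : group_set induced_perms.
Proof.
apply/group_setP; split; first by apply/induced_permsP; exists 1%g; exact: induces1.
move=> p q /induced_permsP[s sp] /induced_permsP[t tq]; apply/induced_permsP.
by exists (t * s)%g; exact: inducesM.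
Qed.

Definition induced_group : {group {perm X}} := Group induced_group_set.

Definition aut_lift (p : {perm X}) : gal j := xget 1%g (fun s => induces s p).

Lemma aut_liftP p : p \in induced_group -> induces (aut_lift p) p.
Proof.
by move=> /induced_permsP[s sp]; rewrite /aut_lift; case: xgetP => [t _ //|/(_ s)].
Qed.

(* [y] is recovered from the odd family of its translates by coset representatives. *)
Lemma odd_index_fixed (S : {group {perm X}}) y : S \subset induced_group ->
  odd #|induced_group : S|%g ->
  (forall s p, induces s p -> p \in S -> s y = y) -> y \in N.
Proof.
move=> SG Sodd yS; pose h (R : {set {perm X}}) : gal j := aut_lift (repr R).
pose L := enum (rcosets S induced_group).
have LP R : R \in L -> exists2 p, p \in induced_group & R = (S :* p)%g.
  by rewrite mem_enum => /rcosetsP.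
have hP R : R \in L -> induces (h R) (repr R).
  move=> /LP[p pG ->]; apply: aut_liftP.
  have : repr (S :* p)%g \in (S :* p)%g by exact: mem_repr_rcoset.
  by case/rcosetP => q qS ->; rewrite groupM // (fintype.subsetP SG).
(* Two automorphisms inducing elements of the same coset differ by one that induces an element of
   [S] and hence fixes [y], so the conjugate depends only on [R]. *)
have hE R s p : R \in L -> induces s p -> p \in R -> s y = h R y.
  move=> RL sp pR; have hR := hP R RL.
  have := inducesM (inducesV hR) sp => rel; apply: (@gal_inj _ _ _ (h R)^-1%g).
  rewrite galVK -gal_mulE; apply: yS rel _.
  by have [q qG RE] := LP R RL; rewrite -mem_rcoset RE rcoset_repr -RE.
apply: (odd_orbit (l := map h L)).
- by rewrite size_map -cardE.
- by move=> _ /mapP[R RL ->]; case: (hP R RL).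
- move=> s sN; have [q sq] := induces_exists sN.
  have qG : q \in induced_group by apply/induced_permsP; exists s.
  have act_L R : R \in L -> (R :* q)%g \in L.
    move=> /LP[p pG ->]; rewrite mem_enum; apply/rcosetsP.
    by exists (p * q)%g; [exact: groupM|rewrite rcosetM].
  rewrite -!map_comp.
  have -> : [seq (s \o ((fun t : gal j => t y) \o h)) R | R <- L] =
      [seq h R y | R <- [seq (R :* q)%g | R <- L]].
    rewrite -map_comp; apply/eq_in_map => R RL /=.
    rewrite -gal_mulE; apply: (hE _ _ _ (act_L R RL) (inducesM sq (hP R RL))).
    apply/rcosetP; exists (repr R) => //.
    by have [p _ ->] := LP R RL; exact: mem_repr_rcoset.
  apply: perm_map; have uq : uniq [seq (R :* q)%g | R <- L].
    by rewrite map_inj_uniq ?enum_uniq //; exact: rcoset_inj.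
  apply: uniq_perm => //; first exact: enum_uniq.
  have sub : {subset [seq (R :* q)%g | R <- L] <= L}.
    by move=> _ /mapP[R RL ->]; exact: act_L.
  by have [_] := uniq_min_size uq sub (eq_leq (esym (size_map _ L))).
Qed.

(* The generic element [\sum_i c_i 'X^i] has trivial stabiliser, and the
   product of ['X - p *: it] over a Sylow 2-subgroup has coefficients in [N]. *)
Lemma induced_pgroup : (2.-group induced_group)%g.
Proof.
have [S /and3P[SG S2 S2']] := Sylow_exists 2 induced_group.
have Sodd : odd #|induced_group : S|%g by move: S2'; rewrite p'natE // dvdn2 negbK.
suff GS : induced_group \subset S by apply: pgroupS GS S2.
pose P : {poly Fs} := \poly_(i < size c) c`_i.
pose tr (s : gal j) : {poly Fs} := map_poly s P.
have tr_eq s t p : induces s p -> induces t p -> tr s = tr t.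
  move=> [_ sp] [_ tp]; apply/polyP => i; rewrite !coef_map coef_poly.
  case: ltnP => ic; last by rewrite !raddf0.
  have iX := mem_nth 0 ic.
  by have /= -> := sp (SeqSub iX); have /= -> := tp (SeqSub iX).
have tr_inj s t p q : induces s p -> induces t q -> tr s = tr t -> p = q.
  move=> [_ sp] [_ tq] /polyP st; apply/permP => x; apply: val_inj.
  rewrite -sp -tq; have := st (index (val x) c); rewrite !coef_map coef_poly.
  by rewrite index_mem (valP x) nth_index ?(valP x).
pose Q : {poly {poly Fs}} := \prod_(p in S) ('X - (tr (aut_lift p))%:P).
have act_Q (s : gal j) : map_poly (map_poly s) Q =
    \prod_(p in S) ('X - (tr (s * aut_lift p)%g)%:P).
  rewrite rmorph_prod; apply: eq_bigr => p _; rewrite rmorphB /= map_polyX map_polyC /=.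
  congr (_ - _%:P); rewrite /tr; apply/polyP => i.
  by rewrite !coef_map.
have QN i k : Q`_i`_k \in N.
  apply: (odd_index_fixed SG Sodd) => s q sq qS.
  suff {2}<- : map_poly (map_poly s) Q = Q by rewrite !coef_map.
  rewrite act_Q /Q [RHS](reindex_inj (mulIg q)) /=; apply: eq_big => [p|p pS].
    by rewrite groupMr.
  congr ('X - _%:P); apply: (tr_eq _ _ (p * q)%g).
    by apply: inducesM => //; apply: aut_liftP; rewrite (fintype.subsetP SG).
  by apply: aut_liftP; rewrite (fintype.subsetP SG) // groupM.
apply/fintype.subsetP => q /induced_permsP[s sq]; have [sN _] := sq.
have QE : map_poly (map_poly s) Q = Q.
  by apply/polyP => i; apply/polyP => k0; rewrite !coef_map /= sN.
(* Since [s] fixes [Q], it moves the factor at [p = 1] to another factor of [Q]. So [tr s] is one of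
   the [tr] attached to [S], and [tr] determines the permutation. *)
have : root Q (tr s).
  rewrite -QE act_Q /root horner_prod; apply/prodf_eq0.
  exists 1%g; first exact: group1.
  rewrite !hornerE subr_eq0; apply/eqP; apply: (tr_eq _ _ q) => //.
  rewrite -[q]mul1g; apply: inducesM => //; apply: aut_liftP; exact: group1.
rewrite /root horner_prod => /prodf_eq0[p pS].
rewrite !hornerE subr_eq0 => /eqP trs.
by rewrite (tr_inj _ _ _ _ sq (aut_liftP (fintype.subsetP SG p pS)) trs).
Qed.

End OneOrbit.

Variable O : valring Fs.
Hypothesis vmax2 : 2%:R \notin vmax O.

Definition wild (s : gal j) := fixes s /\ forall z, z != 0 -> s z / z \in vone O.

Lemma wildX s n : wild s -> wild (s ^+ n)%g.
Proof.
move=> [sN sw]; elim: n => [|n [IHN IHw]].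
  by split=> [|z z0]; [exact: fixes1|rewrite gal1E mulfV // rpred1].
rewrite expgSr; split=> [|z z0]; first exact: fixesM.
rewrite gal_mulE; apply: vone_trans (sw z z0).
by apply: IHw; rewrite fmorph_eq0.
Qed.

(* Otherwise a power [t] of [s] has order 2 on some orbit and negates
   [y = x - t x], so that [t y / y = -1] is not in [1 + m]. *)
Lemma wild_trivial s : wild s -> s = 1%g.
Proof.
move=> sw; apply: gal_ext => z; have [sN _] := sw.
have c_stable t w : fixes t -> w \in orb sep N z -> t w \in orb sep N z.
  exact: orb_stable.
have [p sp] := induces_exists c_stable sN.
have pG : p \in induced_group (orb sep N z) by apply/induced_permsP; exists s.
suff p1 : p = 1%g.
  by have [_ /(_ (SeqSub (orb_id sep N z)))] := sp; rewrite p1 perm1.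
have /p_natP[a pa] : 2%N.-nat #[p]%g.
  exact: mem_p_elt (induced_pgroup c_stable) pG.
case: a pa => [|a] pa; first by apply/eqP; rewrite -order_eq1 pa.
have p2 : (p ^+ (2 ^ a) ^+ 2 = 1)%g by rewrite -expgM -expnSr -pa expg_order.
have p1 : (p ^+ (2 ^ a) != 1)%g.
  by rewrite -order_dvdn pa dvdn_Pexp2l // ltnn.
set q := (p ^+ (2 ^ a))%g in p1 p2; pose t := (s ^+ (2 ^ a))%g.
have [tN tq] : induces t q by exact: inducesX.
have [_ tw] := wildX (2 ^ a) sw.
have [x qx] : exists x, q x != x.
  apply: contrapT => nx; case/negP: p1; apply/eqP/permP => x; rewrite perm1.
  by apply/eqP; apply: contraT => qx; case: nx; exists x.
pose y := val x - t (val x).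
have tt : t (t (val x)) = val x.
  rewrite !tq; congr val.
  by have := congr1 (fun r : {perm _} => r x) p2; rewrite expgS expg1 permM perm1.
have ty : t y = - y by rewrite /y rmorphB opprB /= tt.
have y0 : y != 0.
  by rewrite subr_eq0 tq; apply: contra qx => /eqP/val_inj xq; rewrite -xq.
have := tw y y0; rewrite ty mulNr mulfV // voneE -opprD rpredN.
by rewrite (negPf vmax2).
Qed.

End TwoGroup.

(** * Henselianity and commutativity *)

Section Henselian.
Variables (F Fs : fieldType) (j : {rmorphism F -> Fs}).
Hypothesis sep : is_separable_closure j.
Variables (k : closedFieldType) (rho : {rmorphism k -> Fs}).
Variables (O : valring Fs) (T : set Fs).
Hypothesis T_neq0 : forall t, T t -> t != 0.
Hypothesis TM : forall t u, T t -> T u -> T (t * u).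
Hypothesis TV : forall t, T t -> T t^-1.
Hypothesis T_rho : forall c, c != 0 -> T (rho c).
Hypothesis T_unit : forall t, T t -> t \in vunit O -> exists c, t = rho c.
Hypothesis vmax2 : 2%:R \notin vmax O.
Variable N : divringClosed Fs.
Hypothesis jN : forall a, j a \in N.
Hypothesis rhoN : forall c, rho c \in N.
Hypothesis Nmax : maximal_in O T N.
Local Notation E := (almost_monomial O T).
Local Notation fixes := (@fixes F Fs j N).
Local Notation orb := (orb sep N).

(** [N[y]] is already a field, everything being algebraic over a subfield of [N]; so maximality can
    be tested on polynomial values alone. *)
Lemma maximal_simple y :
  (forall g : {poly Fs}, g \is a polyOver N -> E g.[y]) -> y \in N.
Proof.
move=> gE; pose A x := exists2 g : {poly Fs}, g \is a polyOver N & x = g.[y].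
have A1 : A 1 by exists 1; [exact: rpred1|rewrite hornerC].
have AB x z : A x -> A z -> A (x - z).
  by move=> [g gN ->] [h hN ->]; exists (g - h); [exact: rpredB|rewrite !hornerE].
have AM x z : A x -> A z -> A (x * z).
  by move=> [g gN ->] [h hN ->]; exists (g * h); [exact: rpredM|rewrite !hornerE].
have NA x : x \in N -> A x by exists x%:P; [rewrite polyOverC|rewrite hornerC].
have [M0 M0P] := subring_of_set A1 AB AM.
have AV x : A x -> A x^-1.
  move=> /M0P xM; apply/M0P; apply: (subring_algebraic_inv sep) xM => a.
  exact/M0P/NA/jN.
have [M MP] := subfield_of_set A1 AB AM AV.
case: Nmax => _ /(_ M) Nm; apply: Nm => [x xN|x|]; first exact/MP/NA.
  by move=> /MP[g gN ->]; exact: gE.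
by apply/MP; exists 'X; [exact: polyOverX|rewrite hornerX].
Qed.

Lemma horner_fixes s (g : {poly Fs}) y : fixes s -> g \is a polyOver N ->
  s g.[y] = g.[s y].
Proof.
move=> sN /polyOverP gN; rewrite -horner_map; congr (_.[_]).
by apply/polyP => i; rewrite coef_map /= sN.
Qed.

(** Each pair excludes at most one exponent: past an exponent giving a unit, the product falls into
    the maximal ideal. *)
Lemma power_not_unit (l : seq (Fs * Fs)) : exists M, forall m, (M <= m)%N ->
  forall p, p \in l -> p.2 \in vmax O -> p.1 * p.2 ^+ m \notin vunit O.
Proof.
elim: l => [|p l [M IH]]; first by exists 0%N.
have [[m0 pm0]|np] := pselect (exists m0, p.1 * p.2 ^+ m0 \in vunit O); last first.
  exists M => m Mm q; rewrite in_cons => /orP[/eqP -> _|]; last exact: IH.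
  by apply/negP => pm; apply: np; exists m.
exists (maxn M m0.+1) => m; rewrite geq_max => /andP[Mm m0m] q.
rewrite in_cons => /orP[/eqP -> pmax|]; last exact: IH.
apply: vmax_vunit; rewrite -(subnKC m0m) exprD exprSr !mulrA -mulrA.
apply: vmaxMl; first by case/vunitP: pm0.
by apply: vmaxMr => //; apply: rpredX; exact: vmaxW.
Qed.

(* For [z] in [N[y]] and [b = y / a] in [1 + m], some [u = z * b ^+ m] has a value
   different from those of its other conjugates; hence [u] is the ratio of two
   products of conjugates of [u] that strictly dominate their own conjugates. *)
Lemma dominant_fixed y :
  (forall s, fixes s -> s y = y \/ s y / y \in vmax O) -> y \in N.
Proof.
move=> ydom; have [->|y0] := eqVneq y 0; first exact: rpred0.
have [a aN ya] := dominant_sim sep jN y0 ydom; pose b := y / a.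
have sb s : fixes s -> s b = s y / a.
  by move=> sN; rewrite /b rmorphM fmorphV /= [s a]sN.
apply: maximal_simple => g gN; pose z := g.[y]; rewrite -/z.
have [z0|z0] := eqVneq z 0; first by left.
(* If [s] moves [y], then [s b / b = s y / y] is infinitesimal, so a large [m] separates the value
   of [s u] from that of [u], while [b ^+ m] in [1 + m] leaves the leading term of [z] unchanged. *)
have [m m_large] := power_not_unit [seq (w / z, v / y) | w <- orb z, v <- orb y].
pose u := z * b ^+ m; have b0 : b != 0 by exact: vone_neq0 ya.
have u0 : u != 0 by rewrite mulf_neq0 // expf_neq0.
have [_ a0] := vone_div_neq0 ya.
have su s : fixes s -> s u = u \/ s u / u \notin vunit O.
  move=> sN; have [sy|sy] := ydom s sN.
    by left; rewrite /u rmorphM rmorphXn /= sb // sy /z horner_fixes // sy.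
  right; rewrite /u rmorphM rmorphXn /= sb //.
  have -> : s z * (s y / a) ^+ m / (z * b ^+ m) = s z / z * (s y / y) ^+ m.
    rewrite -mulf_div -expr_div_n; congr (_ * _ ^+ _).
    by rewrite /b; field; rewrite y0 a0.
  apply: (m_large _ (leqnn _) (s z / z, s y / y)) => //.
  by apply: allpairs_f; apply/orbP; exists s.
have c0 : 0 \notin orb u.
  by apply/negP => /orbP[s _ /eqP]; rewrite eq_sym fmorph_eq0 (negPf u0).
have nzc v : v \in orb u -> v != 0 by apply: contraTneq => ->.
have div_u v v' : v != 0 -> v' / v = (v' / u) * (u / v).
  by move=> v0; field; rewrite v0 u0.
(* The conjugates strictly larger than [u], and those at least as large. Both are parts to which
   [small_part_prod] applies, and they differ by [u] alone. *)
pose pA := [pred v | u / v \in vmax O]; pose pA' := [pred v | v / u \notin vmax O].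
have thA v v' : v \in orb u -> v' \in orb u -> pA v -> ~~ pA v' -> v' / v \in vmax O.
  move=> /nzc v0 _ /= uv uv'; rewrite div_u //; apply: vmaxMl => //.
  by rewrite -invf_div; exact: nvmaxV.
have thA' v v' : v \in orb u -> v' \in orb u -> pA' v -> ~~ pA' v' -> v' / v \in vmax O.
  move=> /nzc v0 _ /= vu /negPn v'u; rewrite div_u //; apply: vmaxMr => //.
  by rewrite -invf_div; exact: nvmaxV.
have pAA' v : v \in orb u -> v != u -> pA' v = pA v.
  move=> vc vu; have v0 := nzc v vc; apply/idP/idP => /= [vum|uvm].
    have uvO : u / v \in O by rewrite -invf_div; exact: nvmaxV.
    rewrite -invf_div; apply: nvalringV; apply/negP => vuO.
    case/orbP: vc => s sN vE; case: (su s sN) => [sE|]; first by rewrite vE sE eqxx in vu.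
    by rewrite -vE vunitE vuO vum.
  apply/negP => vum; have := vmaxMl (vmaxW uvm) vum.
  by rewrite mulrA divfK // mulfV // (negPf (vmax1 O)).
pose PA := \prod_(v <- orb u | pA v) v; pose PA' := \prod_(v <- orb u | pA' v) v.
have PA0 (p : pred Fs) : \prod_(v <- orb u | p v) v != 0.
  rewrite big_seq_cond; elim/big_ind: _ => [|v w v0 w0|v /andP[/nzc//]].
    exact: oner_neq0.
  by rewrite mulf_neq0.
have PAA' : PA' = u * PA.
  rewrite /PA' -big_filter (bigD1_seq u) ?filter_uniq ?orb_uniq //=; last first.
    by rewrite mem_filter orb_id /= mulfV // vmax1.
  rewrite big_filter_cond /=.
  congr (_ * _); rewrite /PA big_seq_cond [RHS]big_seq_cond; apply: eq_bigl => v.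
  case: (boolP (v \in orb u)) => //= vc; have [->|vu] := eqVneq v u.
    by rewrite andbF mulfV // (negPf (vmax1 O)).
  by rewrite andbT; exact: pAA'.
have simN (p : pred Fs) : (forall v v', v \in orb u -> v' \in orb u -> p v -> ~~ p v' ->
    v' / v \in vmax O) -> exists2 n, n \in N &
    (\prod_(v <- orb u | p v) v) / n \in vone O.
  move=> thp; apply: (dominant_sim sep) => // s sN.
  have := small_part_prod thp c0 (orb_perm sep u) sN.
  by case=> [[-> _]|?]; [left|right].
have [n nN PAn] := simN _ thA; have [n' n'N PAn'] := simN _ thA'.
have z_sim : z / (n' / n) \in vone O.
  have -> : z / (n' / n) = (PA' / n') / (PA / n) / b ^+ m.
    have [_ n0] := vone_div_neq0 PAn; have [_ n'0] := vone_div_neq0 PAn'.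
    rewrite PAA' /u; move: (PA0 pA); rewrite -/PA => PA0'.
    by field; rewrite PA0' n0 n'0 expf_neq0.
  by rewrite rpred_div ?rpredX // rpred_div.
apply: almost_monomial_sim z_sim => //.
by case: Nmax => NE _; apply: NE; exact: rpred_div.
Qed.

(** Uniqueness of the extension of the valuation. The product of the conjugates of largest size is
    dominant, hence in [N] and fixed; so the set of these conjugates is preserved, and by
    transitivity it is the whole orbit. *)
Lemma fixes_vunit s z : fixes s -> z != 0 -> s z / z \in vunit O.
Proof.
move=> sN z0; have c0 : 0 \notin orb z.
  by apply/negP => /orbP[t _ /eqP]; rewrite eq_sym fmorph_eq0 (negPf z0).
have nzc v : v \in orb z -> v != 0 by apply: contraTneq => ->.
have [u uc umin] := seq_vmin O (orb_id sep N z) c0; have u0 := nzc u uc.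
pose p := [pred v | v / u \notin vmax O].
have thp v v' : v \in orb z -> v' \in orb z -> p v -> ~~ p v' -> v' / v \in vmax O.
  move=> vc _ /= vu /negPn v'u; have v0 := nzc v vc.
  have -> : v' / v = v' / u * (v / u)^-1 by field; rewrite u0 v0.
  by apply: vmaxMr => //; exact: nvmaxV.
pose y := \prod_(v <- orb z | p v) v.
have y0 : y != 0.
  rewrite /y big_seq_cond; elim/big_ind: _ => [|v w v0 w0|v /andP[/nzc//]].
    exact: oner_neq0.
  by rewrite mulf_neq0.
have yN : y \in N.
  apply: dominant_fixed => t tN.
  have := small_part_prod thp c0 (orb_perm sep z) tN.
  by case=> [[-> _]|?]; [left|right].
have pE t v : fixes t -> v \in orb z -> p (t v) = p v.
  move=> tN vc; have := small_part_prod thp c0 (orb_perm sep z) tN.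
  case=> [[_ -> //]|]; rewrite -/y [t y]tN //.
  by rewrite mulfV // (negPf (vmax1 O)).
have unit_u t : fixes t -> t z / u \in vunit O.
  move=> tN; have tzc : t z \in orb z by apply/orbP; exists t.
  rewrite vunitE umin //=; case/orbP: (uc) => r rN uE.
  have -> : t z = (t * r^-1)%g u by rewrite gal_mulE uE galVK.
  have /= -> := pE (t * r^-1)%g u _ uc; last by apply: fixesM => //; exact: fixesV.
  by rewrite mulfV // vmax1.
have -> : s z / z = (s z / u) / (z / u) by field; rewrite u0 z0.
by apply: rpred_div; [exact: unit_u|exact: (unit_u 1%g)].
Qed.

Lemma fixes_vmax s z : fixes s -> z \in vmax O -> s z \in vmax O.
Proof.
move=> sN zm; have [->|z0] := eqVneq z 0; first by rewrite rmorph0 rpred0.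
by rewrite -(divfK z0 (s z)) vmaxMl //; case/vunitP: (fixes_vunit sN z0).
Qed.

Lemma fixes_valring s z : fixes s -> z \in O -> s z \in O.
Proof.
move=> sN zO; have [->|z0] := eqVneq z 0; first by rewrite rmorph0 rpred0.
by rewrite -(divfK z0 (s z)) rpredM //; case/vunitP: (fixes_vunit sN z0).
Qed.

Lemma fixes_vone s z : fixes s -> z \in vone O -> s z \in vone O.
Proof. by rewrite !voneE => sN /(fixes_vmax sN); rewrite rmorphB rmorph1. Qed.

(** The orbit polynomial of [v] has integral coefficients in [N], each congruent to a constant.
    Replacing them gives a monic polynomial over [k] of which [v] is a root modulo the maximal
    ideal. *)
Lemma residue_exists v : v \in O -> exists c, v - rho c \in vmax O.
Proof.
move=> vO; pose f := \prod_(w <- orb v) ('X - w%:P).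
have fN : f \is a polyOver N by exact: (stable_prod_XsubC sep jN (orb_perm sep v)).
have fO : f \is a polyOver O.
  rewrite /f big_seq; apply: rpred_prod => w /orbP[s sN ->].
  by rewrite rpredB ?polyOverX // polyOverC fixes_valring.
have fv : f.[v] = 0.
  rewrite /f (bigD1_seq v) ?orb_id ?orb_uniq //= hornerM !hornerE.
  by rewrite subrr mul0r.
have coefP i : {c | f`_i - rho c \in vmax O}.
  apply/cid/(almost_monomial_residue T_neq0 T_unit); last exact: (polyOverP fO).
  by case: Nmax => NE _; apply: NE; exact: (polyOverP fN).
pose n := size (orb v); have fsize : size f = n.+1 by rewrite size_prod_XsubC.
have fmonic : f \is monic by exact: monic_prod_XsubC.
(* The top coefficient is set to 1 by hand, since the constant chosen for it is only congruent to
   1. *)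
pose h := \poly_(i < n.+1) (if i == n then 1 else projT1 (coefP i)).
have hm : h \is monic.
  by rewrite monicE lead_coef_poly //= eqxx ?oner_neq0.
apply: rho_root_mod hm _.
have -> : (map_poly rho h).[v] = \sum_(i < n.+1) (rho h`_i - f`_i) * v ^+ i.
  rewrite -[LHS]subr0 -[X in _ - X = _]fv (horner_coef f) fsize.
  rewrite (@horner_coef_wide _ n.+1) ?size_map_poly ?size_poly // -sumrB.
  by apply: eq_bigr => i _; rewrite coef_map mulrBl.
apply: rpred_sum => i _; apply: vmaxMr; first exact: rpredX.
rewrite coef_poly ltn_ord; have [->|_] := eqVneq (i : nat) n.
  have -> : f`_n = 1 by have := monicP fmonic; rewrite lead_coefE fsize.
  by rewrite rmorph1 subrr rpred0.
by rewrite -opprB rpredN; exact: (projT2 (coefP i)).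
Qed.

Lemma residue_unit w : w \in vunit O -> exists2 e, e != 0 & w / rho e \in vone O.
Proof.
move=> wu; have [w0 wO _] := vunitP _ _ wu; have [e we] := residue_exists wO.
have e0 : e != 0.
  apply: contraTneq we => ->; rewrite rmorph0 subr0.
  by move: wu; rewrite vunitE => /andP[].
exists e => //; apply: vone_sym; apply: vone_sub => //; apply: vmaxMr.
  by case/vunitP: wu.
by rewrite -opprB rpredN.
Qed.

Lemma tame_character s z : fixes s -> z != 0 ->
  exists2 e, e != 0 & s z / (rho e * z) \in vone O.
Proof.
move=> sN z0; have [e e0 ze] := residue_unit (fixes_vunit sN z0).
by exists e => //; rewrite invfM mulrA mulrAC.
Qed.

(** For [u] in [N[z]] the norm along [l] lies in [N] and, by the tame characters, has the leading
    term of a constant times [u ^+ size l]. As [size l] is odd, [u] inherits almost monomiality from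
    its norm; here the odd exponents pay off. *)
Lemma odd_orbit z (l : seq (gal j)) : odd (size l) ->
  (forall s, s \in l -> fixes s) ->
  stable_seq j N (map (fun s : gal j => s z) l) -> z \in N.
Proof.
move=> lodd lN lst; apply: maximal_simple => g gN; pose u := g.[z]; rewrite -/u.
have [u0|u0] := eqVneq u 0; first by left.
pose n := \prod_(s <- l) (s : gal j) u.
have nE : n = \prod_(w <- map (fun s : gal j => s z) l) g.[w].
  rewrite big_map /n big_seq [RHS]big_seq; apply: eq_bigr => s /lN sN.
  exact: horner_fixes.
have nN : n \in N.
  apply: (fixed_in sep jN) => t tN; rewrite nE rmorph_prod /=.
  rewrite (eq_bigr (fun w => g.[t w])); last by move=> w _; exact: horner_fixes.
  by rewrite -(big_map t xpredT (fun w => g.[w])) (perm_big _ (lst t tN)).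
have [e e0 ne] : exists2 e, e != 0 & n / (rho e * u ^+ size l) \in vone O.
  rewrite /n; elim: (l) lN => [|s r IH] rN.
    by exists 1; rewrite ?oner_neq0 // big_nil rmorph1 mulr1 divr1 rpred1.
  have [|e e0 re] := IH; first by move=> t tr; apply: rN; rewrite in_cons tr orbT.
  have [e' e'0 se'] := tame_character (rN s (mem_head _ _)) u0.
  exists (e' * e); first by rewrite mulf_neq0.
  rewrite big_cons rmorphM /= exprS mulrACA; exact: voneM.
have [NE _] := Nmax; case: (NE n nN) => [n0|[d [t [dodd Tt nt]]]].
  by have [] := vone_div_neq0 ne; rewrite n0 eqxx.
right; exists (size l * d)%N, (t / rho e ^+ d); split.
- by rewrite oddM lodd.
- by apply: TM => //; apply: TV; rewrite -rmorphXn; apply: T_rho; rewrite expf_neq0.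
have eN0 : rho e != 0 by rewrite fmorph_eq0.
have -> : u ^+ (size l * d) / (t / rho e ^+ d) =
    (n ^+ d / t) / (n / (rho e * u ^+ size l)) ^+ d.
  have [n0 _] := vone_div_neq0 ne; have t0 := T_neq0 Tt.
  rewrite exprM; move: (u ^+ size l) (expf_neq0 (size l) u0) => v v0.
  rewrite expr_div_n exprMn; field.
  by rewrite t0 !expf_neq0.
by rewrite rpred_div // rpredX.
Qed.

(** Constants are fixed by both, so the characters multiply and [s * t], [t * s] act alike on
    leading terms. Their quotient is wild, hence trivial. *)
Lemma fixes_commute s t : fixes s -> fixes t -> (s * t = t * s)%g.
Proof.
move=> sN tN; have conj_sim (s' t' : gal j) z : fixes s' -> fixes t' -> z != 0 ->
    forall e f, t' z / (rho e * z) \in vone O -> s' z / (rho f * z) \in vone O ->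
    s' (t' z) / (rho e * rho f * z) \in vone O.
  move=> s'N t'N z0 e f te sf; apply: (@vone_trans _ _ (s' (rho e * z))).
    have := fixes_vone s'N te.
    by rewrite rmorphM fmorphV.
  have [re0 _] : rho e * z != 0 /\ True by split=> //; case/vone_div_neq0: te.
  have e0 : rho e != 0 by move: re0; rewrite mulf_eq0 negb_or => /andP[].
  rewrite rmorphM /= [s' (rho e)]s'N // -mulrA -mulf_div mulfV // mul1r.
  exact: sf.
suff st1 : (s * t * (t * s)^-1 = 1)%g by rewrite -(mulgKV (t * s)%g (s * t)%g) st1 mul1g.
apply: (wild_trivial sep (@odd_orbit) vmax2).
split; first by do !apply: fixesM => //; apply: fixesV; exact: fixesM.
move=> z0 z00; pose z := ((t * s)^-1)%g z0.
have z0E : z0 = t (s z) by rewrite -gal_mulE /z galKV.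
have zn0 : z != 0 by rewrite fmorph_eq0.
have [e e0 te] := tame_character tN zn0.
have [f f0 sf] := tame_character sN zn0.
have st := conj_sim s t z sN tN zn0 e f te sf.
have ts := conj_sim t s z tN sN zn0 f e sf te.
rewrite gal_mulE -/z gal_mulE [X in _ / X]z0E; apply: vone_trans st _.
by apply: vone_sym; rewrite [rho e * _]mulrC.
Qed.

End Henselian.

(** * The monomial valuation *)

Lemma seq_min (disp : Order.disp_t) (T : orderType disp) (r : seq T) a : a \in r ->
  exists2 b, b \in r & forall d, d \in r -> (b <= d)%O.
Proof.
elim: r a => [//|x r IH] a _; case: r IH => [_|y r IH].
  by exists x; rewrite ?mem_head // => d; rewrite inE => /eqP ->.
have [b br bmin] := IH y (mem_head _ _); have [xb|bx] := leP x b.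
  exists x; first exact: mem_head.
  by move=> d; rewrite in_cons => /orP[/eqP -> //|/bmin]; exact: le_trans.
exists b; first by rewrite in_cons br orbT.
by move=> d; rewrite in_cons => /orP[/eqP -> |/bmin//]; exact: ltW.
Qed.

Section MonomialValuation.
Variables (k : closedFieldType) (Fs : fieldType) (n : nat).
Variable ev : {rmorphism {mpoly k[n]} -> Fs}.
Hypothesis ev_inj : injective ev.
Variable Ok : valring k.
Local Notation rho := (ev \o @mpolyC n k).
Local Notation X b := (ev 'X_[b]).

(* Numerators of elements [p / X^b] that are integral, respectively
   topologically small, when the variables are infinitesimal with respect to
   every positive valuation of [k]. *)
Definition integral_at (b : 'X_{1..n}) (p : {mpoly k[n]}) := forall a,
  p@_a \in Ok /\ ((a < b)%O -> p@_a \in vmax Ok).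
Definition small_at (b : 'X_{1..n}) (p : {mpoly k[n]}) := forall a,
  p@_a \in Ok /\ ((a <= b)%O -> p@_a \in vmax Ok).

Lemma small_integral b p : small_at b p -> integral_at b p.
Proof. by move=> pb a; have [pO pm] := pb a; split=> // /ltW. Qed.

Lemma integral_atB b p q : integral_at b p -> integral_at b q -> integral_at b (p - q).
Proof.
move=> pb qb a; have [pO pm] := pb a; have [qO qm] := qb a.
by rewrite mcoeffB; split=> [|ab]; rewrite rpredB ?pm ?qm.
Qed.

Lemma small_atB b p q : small_at b p -> small_at b q -> small_at b (p - q).
Proof.
move=> pb qb a; have [pO pm] := pb a; have [qO qm] := qb a.
by rewrite mcoeffB; split=> [|ab]; rewrite rpredB ?pm ?qm.
Qed.

(** If two exponents add up to less than [b + d], the first is below [b] or the second below [d]. *)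
Lemma integral_atM b d p q : integral_at b p -> integral_at d q ->
  integral_at (b + d)%MM (p * q).
Proof.
move=> pb qd a; rewrite mcoeffM; split=> [|abd].
  by apply: rpred_sum => i _; rewrite rpredM //; [case: (pb i.1)|case: (qd i.2)].
apply: rpred_sum => i /eqP aE.
have [pO pm] := pb i.1; have [qO qm] := qd i.2.
have [ib|bi] := ltP (i.1 : 'X_{1..n}) b; first by rewrite vmaxMr // pm.
rewrite vmaxMl // qm // ltNge; apply: contraTN abd => di.
by rewrite -leNgt aE lem_add.
Qed.

Lemma small_atM b d p q : integral_at b p -> small_at d q ->
  small_at (b + d)%MM (p * q).
Proof.
move=> pb qd a; split=> [|abd].
  by have [] := integral_atM pb (small_integral qd) a.
rewrite mcoeffM; apply: rpred_sum => i /eqP aE.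
have [pO pm] := pb i.1; have [qO qm] := qd i.2.
have [ib|bi] := ltP (i.1 : 'X_{1..n}) b; first by rewrite vmaxMr // pm.
rewrite vmaxMl // qm // leNgt; apply: contraTN abd => di.
by rewrite -ltNge aE lemc_lt_add.
Qed.

Lemma integral_atX b : integral_at b 'X_[b].
Proof.
move=> a; rewrite mcoeffX; split; first exact: rpred_nat.
by move=> ab; rewrite gt_eqF // rpred0.
Qed.

Lemma X_neq0 b : X b != 0.
Proof.
rewrite -(rmorph0 ev) (inj_eq ev_inj); apply/eqP => /(congr1 (mcoeff b)) /eqP.
by rewrite mcoeffX eqxx mcoeff0 oner_eq0.
Qed.

Lemma XD b d : X (b + d)%MM = X b * X d.
Proof. by rewrite mpolyXD rmorphM. Qed.

(** Chevalley's theorem for the ring of integral fractions and the ideal of small ones, which is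
    proper because ['X_[b]] has coefficient 1 at [b]. This corresponds to the Gauss extension of
    [Ok] refined by the monomial order on the residue field. *)
Lemma monomial_valring : exists O : valring Fs,
  (forall b p, integral_at b p -> ev p / X b \in O) /\
  (forall b p, small_at b p -> ev p / X b \in vmax O).
Proof.
pose U z := exists b p, integral_at b p /\ z = ev p / X b.
pose V z := exists b p, small_at b p /\ z = ev p / X b.
have [|O [UO VO]] := @valring_exists _ U V; last first.
  by exists O; split=> b p bp; [apply: UO|apply: VO]; exists b, p.
have divB b d p q : ev p / X b - ev q / X d =
    ev ('X_[d] * p - 'X_[b] * q) / X (b + d)%MM.
  rewrite subf_div ?X_neq0 // XD rmorphB !rmorphM /=.
  by congr ((_ - _) / _); rewrite mulrC.
have divM b d p q : (ev p / X b) * (ev q / X d) = ev (p * q) / X (b + d)%MM.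
  by rewrite mulf_div XD rmorphM.
split.
- split.
  + exists 0%MM, 1; split; last by rewrite mpolyX0 rmorph1 divr1.
    by rewrite -mpolyX0; exact: integral_atX.
  + move=> _ _ [b [p [bp ->]]] [d [q [dq ->]]].
    exists (b + d)%MM, ('X_[d] * p - 'X_[b] * q); split=> //.
    by apply: integral_atB; [rewrite addmC|]; apply: integral_atM => //;
      exact: integral_atX.
  + move=> _ _ [b [p [bp ->]]] [d [q [dq ->]]].
    by exists (b + d)%MM, (p * q); split=> //; exact: integral_atM.
- by move=> _ [b [p [bp ->]]]; exists b, p; split=> //; exact: small_integral.
- exists 0%MM, 0; split; last by rewrite rmorph0 mul0r.
  by move=> a; rewrite mcoeff0 rpred0; split=> // _; exact: rpred0.
- move=> _ _ [b [p [bp ->]]] [d [q [dq ->]]].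
  exists (b + d)%MM, ('X_[d] * p - 'X_[b] * q); split=> //.
  by apply: small_atB; [rewrite addmC|]; apply: small_atM => //; exact: integral_atX.
- split.
    move=> _ _ [b [p [bp ->]]] [d [q [dq ->]]].
    by exists (b + d)%MM, (p * q); split=> //; exact: small_atM.
  move=> [b [p [bp p1]]]; have pX : p = 'X_[b].
    by apply: ev_inj; rewrite -[RHS]mul1r p1 divfK ?X_neq0.
  have [_ /(_ (lexx b))] := bp b.
  by rewrite pX mcoeffX eqxx (negPf (vmax1 Ok)).
Qed.

Variable O : valring Fs.
Hypothesis O_integral : forall b p, integral_at b p -> ev p / X b \in O.
Hypothesis O_small : forall b p, small_at b p -> ev p / X b \in vmax O.

Lemma monomial_inv c b d :
  rho c^-1 * X d / X b = (rho c * X b / X d)^-1.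
Proof. by rewrite (fmorphV rho) invf_div invfM mulrCA mulrA. Qed.

(** Laurent monomials: two multinomials are needed because exponents are natural numbers. *)
Definition monomial (t : Fs) :=
  exists c b d, c != 0 /\ t = rho c * X b / X d.

Lemma monomial_neq0 t : monomial t -> t != 0.
Proof.
move=> [c [b [d [c0 ->]]]].
by rewrite !mulf_neq0 ?invr_eq0 ?X_neq0 // fmorph_eq0.
Qed.

Lemma monomialM t u : monomial t -> monomial u -> monomial (t * u).
Proof.
move=> [c [b [d [c0 ->]]]] [c' [b' [d' [c'0 ->]]]].
exists (c * c'), (b + b')%MM, (d + d')%MM; split; first by rewrite mulf_neq0.
by rewrite rmorphM /= !XD mulf_div mulrACA.
Qed.

Lemma monomialV t : monomial t -> monomial t^-1.
Proof.
move=> [c [b [d [c0 ->]]]]; exists c^-1, d, b; split; first by rewrite invr_eq0.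
by rewrite monomial_inv.
Qed.

Lemma monomial_rho c : c != 0 -> monomial (rho c).
Proof. by exists c, 0%MM, 0%MM; rewrite mulfK ?X_neq0. Qed.

Lemma rho_valring c : c \in Ok -> rho c \in O.
Proof.
move=> cO; have := @O_integral 0%MM c%:MP.
rewrite mpolyX0 rmorph1 divr1; apply=> a; rewrite mcoeffC.
split=> [|/lt_geF]; first by apply: rpredM cO _; exact: rpred_nat.
by have := lemc_addr 0%MM a; rewrite add0m => ->.
Qed.

Lemma monomial_small c b d : c \in Ok -> ((b <= d)%O -> c \in vmax Ok) ->
  rho c * X b / X d \in vmax O.
Proof.
move=> cO cm; rewrite /= -rmorphM /= mul_mpolyC; apply: O_small => a.
rewrite mcoeffZ mcoeffX; split=> [|ad]; first by apply: rpredM cO _; exact: rpred_nat.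
by have [ab|_] := eqVneq b a; [rewrite mulr1 cm // ab|rewrite mulr0 rpred0].
Qed.

(** The values of the variables are independent modulo those of [k]. For [d < b] the monomial is
    small if [c] is integral; otherwise [c^-1] is in the maximal ideal, outweighs the variables, and
    the inverse is small. *)
Lemma monomial_unit c b d : c != 0 -> rho c * X b / X d \in vunit O -> b = d.
Proof.
wlog bd : c b d / (d <= b)%O.
  move=> wl c0 tu; have [db|/ltW bd] := leP d b; first exact: (wl c).
  apply/esym/(wl c^-1); rewrite ?invr_eq0 //.
  have -> : rho c^-1 * X d / X b = (rho c * X b / X d)^-1.
    by rewrite monomial_inv.
  by rewrite rpredV.
move=> c0 tu; apply/eqP; rewrite eq_le bd andbT leNgt; apply/negP => db.
have [cO|cO] := boolP (c \in Ok).
  have tm : rho c * X b / X d \in vmax O.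
    by apply: monomial_small => //; rewrite leNgt db.
  by rewrite (negPf (vmax_vunit tm)) in tu.
have cm := nvalringV cO.
have tm : rho c^-1 * X d / X b \in vmax O by apply: monomial_small => //; exact: vmaxW.
by have := vmax_vunit tm; rewrite monomial_inv rpredV tu.
Qed.

Lemma monomial_unit_const t : monomial t -> t \in vunit O -> exists c, t = rho c.
Proof.
move=> [c [b [d [c0 ->]]]] tu; exists c.
by rewrite (monomial_unit c0 tu) mulfK ?X_neq0.
Qed.

(** The leading term is found in two stages: coefficients of minimal value first, then the least
    monomial among them. *)
Lemma mpoly_leading (p : {mpoly k[n]}) : p != 0 ->
  exists c b, c != 0 /\ ev p / (rho c * X b) \in vone O.
Proof.
move=> p0; pose cs := [seq p@_a | a <- msupp p].
have cs0 : 0 \notin cs.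
  by apply/negP => /mapP[a]; rewrite mcoeff_msupp => /eqP pa /esym.
have [_ /mapP[a0 a0p ->] cmin] : exists2 c, c \in cs & forall v, v \in cs -> v / c \in Ok.
  apply: (@seq_vmin _ Ok cs p@_(mlead p)) => //.
  by apply: map_f; exact: mlead_supp.
pose S := [seq a <- msupp p | p@_a / p@_a0 \notin vmax Ok].
have a00 : p@_a0 != 0 by rewrite -mcoeff_msupp.
have a0S : a0 \in S by rewrite mem_filter a0p mulfV // vmax1.
have [b bS bmin] : exists2 b, b \in S & forall a, a \in S -> (b <= a)%O. exact: seq_min a0S.
have {bS}[bp bm] : b \in msupp p /\ p@_b / p@_a0 \notin vmax Ok.
  by move: bS; rewrite mem_filter => /andP[].
have b0 : p@_b != 0 by rewrite -mcoeff_msupp.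
have pO a : p@_a / p@_b \in Ok.
  have [ap|ap] := boolP (a \in msupp p); last first.
    by move: ap; rewrite -mcoeff_eq0 => /eqP ->; rewrite mul0r rpred0.
  have -> : p@_a / p@_b = (p@_a / p@_a0) * (p@_b / p@_a0)^-1.
    by field; rewrite a00 b0.
  apply: rpredM; last exact: nvmaxV.
  by apply: cmin; exact: map_f.
have pm a : (a < b)%O -> p@_a / p@_b \in vmax Ok.
  move=> ab; have [ap|ap] := boolP (a \in msupp p); last first.
    by move: ap; rewrite -mcoeff_eq0 => /eqP ->; rewrite mul0r rpred0.
  have -> : p@_a / p@_b = (p@_a / p@_a0) * (p@_b / p@_a0)^-1.
    by field; rewrite a00 b0.
  apply: vmaxMr; first exact: nvmaxV.
  apply: contraTT ab => aS; rewrite -leNgt; apply: bmin.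
  by rewrite mem_filter aS ap.
exists p@_b, b; split=> //; apply: vone_sub.
  by rewrite mulf_neq0 ?X_neq0 // fmorph_eq0.
have -> : (ev p - rho p@_b * X b) / (rho p@_b * X b) =
    ev ((p@_b)^-1 *: p - 'X_[b]) / X b.
  have rV : ev (p@_b)^-1%:MP = (rho p@_b)^-1 := fmorphV rho _.
  have r0 : rho p@_b != 0 by rewrite fmorph_eq0.
  rewrite rmorphB /= -mul_mpolyC rmorphM /= rV.
  by move: r0 => /=; set r := ev _ => r0; field; rewrite X_neq0.
apply: O_small => a; rewrite mcoeffB mcoeffZ mcoeffX mulrC.
split=> [|]; first by rewrite rpredB ?pO ?rpred_nat.
rewrite le_eqVlt => /orP[/eqP ->|ab].
  by rewrite eqxx mulfV // subrr rpred0.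
by rewrite gt_eqF // subr0 pm.
Qed.

Lemma fraction_almost_monomial p q : almost_monomial O monomial (ev p / ev q).
Proof.
have [->|p0] := eqVneq p 0; first by left; rewrite rmorph0 mul0r.
have [->|q0] := eqVneq q 0; first by left; rewrite rmorph0 invr0 mulr0.
right; have [c [b [c0 pE]]] := mpoly_leading p0.
have [e [d [e0 qE]]] := mpoly_leading q0.
exists 1%N, ((rho c * X b) / (rho e * X d)); split=> //.
  exists (c / e), b, d; split; first by rewrite mulf_neq0 ?invr_eq0.
  by rewrite (fmorph_div rho) -mulf_div mulrA.
have := rpred_div pE qE.
by rewrite expr1 !invf_div mulrACA [Z in _ * Z]mulrC -mulrACA.
Qed.

End MonomialValuation.

(** * Evaluation of symbols on commuting tuples *)

Lemma F2_addxx (x : 'F_2) : x + x = 0.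
Proof. by rewrite -mulr2n -mulr_natr pchar_Fp_0 // mulr0. Qed.

Lemma F2_opp (x : 'F_2) : - x = x.
Proof. by apply/eqP; rewrite eq_sym -addr_eq0 F2_addxx. Qed.

Lemma F2_sign (x : 'F_2) n : (-1) ^+ n * x = x.
Proof. by rewrite F2_opp expr1n mul1r. Qed.

Lemma F2_eq01 (x : 'F_2) : x = 0 \/ x = 1.
Proof. by case: x => -[|[|//]] h; [left|right]; apply: val_inj. Qed.

Section CommutingTuples.
Variables (G : groupType) (n : nat) (g : 'I_n.+1 -> G).
Hypothesis g_comm : forall i l, (g i * g l = g l * g i)%g.

Lemma face_swap i (s : 'S_n.+1) (lt_i1 : (i < n.+1)%N) (lt_i : (i.+1 < n.+1)%N) :
  let t := tperm (Ordinal lt_i1) (Ordinal lt_i) in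
  face i.+1 (fun l => g ((t * s)%g l)) = face i.+1 (fun l => g (s l)).
Proof.
move=> t; apply/funext => l; rewrite /face ltnS eqSS.
have t_small (x : 'I_n.+1) : (x < i)%N -> t x = x.
  by move=> xi; apply: tpermD; rewrite -val_eqE /= gtn_eqF // ltnW.
have t_big (x : 'I_n.+1) : (i.+1 < x)%N -> t x = x.
  by move=> xi; apply: tpermD; rewrite -val_eqE /= ltn_eqF // ltnW.
case: ltnP => [li|il]; first by rewrite permM t_small.
case: eqP => [li|/eqP li]; last first.
  by rewrite permM t_big //= /bump /= add1n ltnS ltn_neqAle eq_sym li.
have -> : widen_ord (leqnSn n) l = Ordinal lt_i1 by apply: val_inj.
have -> : lift ord0 l = Ordinal lt_i by apply: val_inj; rewrite /= /bump /= li.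
by rewrite !permM tpermL tpermR g_comm.
Qed.

Lemma sum_even_odd (f : 'S_n.+1 -> 'F_2) (t : 'S_n.+1) : odd_perm t ->
  (forall s, f (t * s)%g = f s) -> \sum_s f s = 0.
Proof.
move=> todd ft; rewrite (bigID (fun s : 'S_n.+1 => odd_perm s)) /=.
rewrite (reindex_inj (mulgI t)) /= [X in X + _](_ : _ = \sum_(s : 'S_n.+1 | ~~ odd_perm s) f s).
  exact: F2_addxx.
by apply: eq_big => s; rewrite ?ft // odd_permM todd.
Qed.

(* The shuffle cycle [\sum_s [g_(s 0) | ... | g_(s n)]] of the bar complex has
   boundary zero when the [g_i] commute. *)
Lemma sum_coboundary (h : cochain G 'F_2 n) :
  \sum_(s : 'S_n.+1) coboundary h (fun l => g (s l)) = 0.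
Proof.
rewrite /coboundary exchange_big /= big_ord_recl big_ord_recr /=.
rewrite [X in _ + (X + _)]big1 ?add0r => [|i _]; last first.
  have lt_i1 : (i < n.+1)%N by exact: leqW.
  have lt_i : (i.+1 < n.+1)%N by rewrite ltnS.
  apply: (@sum_even_odd _ (tperm (Ordinal lt_i1) (Ordinal lt_i))).
    by rewrite odd_tperm -val_eqE /= ltn_eqF.
  by move=> s; rewrite -[bump 0 i]/(i.+1) face_swap.
(* The two outer faces remain. The cyclic shift [l |-> l + 1] turns the last face into face 0, and
   the two equal sums cancel in characteristic 2. *)
rewrite [X in _ + X](reindex_inj (mulgI (lift_perm ord_max ord0 1))) /=.
rewrite [X in _ + X](_ : _ = \sum_(s : 'S_n.+1) (-1) ^+ 0 * h (face 0 (fun l => g (s l)))).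
  exact: F2_addxx.
apply: eq_bigr => s _; rewrite !F2_sign; congr h; apply/funext => l.
rewrite /face /= /bump leq0n add1n ltnS ltn_ord permM; congr (g (s _)).
have -> : widen_ord (leqnSn n) l = lift ord_max l by apply: val_inj; rewrite /= /bump leqNgt ltn_ord.
by rewrite lift_perm_lift perm1.
Qed.

End CommutingTuples.

Section SymbolEvaluation.
Variables (F Fs : fieldType) (j : {rmorphism F -> Fs}).

Lemma symbol_rep n (a : 'I_n -> F) : exists f : cocycle j 'F_2 n,
  symbol j a = cohomology_class f /\
  forall s, cocycle_val f s = \prod_i @kummer_cochain F Fs j (a i) (fun=> s i).
Proof.
elim: n a => [|n IH] a.
  exists (Cocycle (cochain0_1_subproof j)); split=> // s.
  by rewrite big_ord0.
have [f [fE fs]] := IH (fun i => a (lift ord0 i)).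
exists (cocycle_cup (kummer_cocycle j (a ord0)) f); split.
  by rewrite /= fE /square_class cohomology_cup_class.
move=> s; rewrite /= /cup fs big_ord_recl; congr (_ * _).
  by congr kummer_cochain; apply/funext => i; congr s; apply: val_inj; rewrite (ord1 i).
by apply: eq_bigr => i _; congr kummer_cochain; apply/funext => _; congr s; apply: val_inj.
Qed.

Lemma symbol_neq0 n (a : 'I_n -> F) (g : 'I_n -> gal j) :
  (forall i l, (g i * g l = g l * g i)%g) ->
  \det (\matrix_(i, l) @kummer_cochain F Fs j (a i) (fun=> g l)) != 0 ->
  symbol j a <> 0.
Proof.
move=> g_comm /eqP detg sym0; apply: detg.
have [f [fE fs]] := symbol_rep a.
have fB : is_coboundary (cocycle_val f).
  have : cohomology_class f = cohomology_class 0.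
    by rewrite -fE sym0 /cohomology_class raddf0.
  by move=> /cohomology_classP; rewrite subr0.
rewrite /determinant; transitivity (\sum_(s : 'S_n) cocycle_val f (fun l => g (s l))).
  apply: eq_bigr => s _; rewrite F2_sign fs; apply: eq_bigr => i _.
  by rewrite mxE.
case: n a g f g_comm {fE fs sym0} fB => [|n] a g f g_comm /=.
  by move=> ->; rewrite big1.
by move=> [h _ ->]; exact: sum_coboundary.
Qed.

(** No nonzero linear form kills all the vectors [(chi i s)_i], so they span and contain a basis.
    [W] gathers them in a finite set, although there may be infinitely many [s]. *)
Lemma independent_tuple n (P : gal j -> Prop) (chi : 'I_n -> gal j -> 'F_2) :
  (forall e : 'I_n -> 'F_2, (exists i, e i != 0) ->
     exists2 s, P s & \sum_i e i * chi i s != 0) ->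
  exists g : 'I_n -> gal j, (forall i, P (g i)) /\
    \det (\matrix_(i, l) chi i (g l)) != 0.
Proof.
move=> indep.
pose W := [set w : 'rV['F_2]_n | `[< exists2 s, P s & forall i, w 0 i = chi i s >]]%SET.
pose A := \matrix_(r < #|W|) (enum_val r : 'rV['F_2]_n).
have WP (r : 'I_#|W|) : exists2 s, P s & forall i, A r i = chi i s.
  have := enum_valP r; rewrite inE => /asboolP[s Ps sE]; exists s => // i.
  by rewrite mxE sE.
have Afull : row_full A.
  rewrite /row_full -mxrank_tr -[_ == _]/(row_free A^T) -kermx_eq0.
  apply: contraT => /rowV0Pn[u /sub_kermxP uA u0].
  have [i ui] : exists i, u 0 i != 0.
    by move/rV0Pn: u0.
  have [|s Ps /negP[]] := indep (fun i => u 0 i); first by exists i.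
  have sW : \row_i chi i s \in W.
    by rewrite inE; apply/asboolP; exists s => // l; rewrite mxE.
  move/matrixP/(_ 0 (enum_rank_in sW (\row_i chi i s))): uA; rewrite !mxE => {}uA.
  rewrite -[X in _ == X]uA; apply/eqP.
  by apply: eq_bigr => l _; rewrite !mxE enum_rankK_in // mxE.
pose g l := projT1 (cid2 (WP (fullrankfun Afull l))).
have gP l : P (g l) by rewrite /g; case: cid2.
have gE l i : A (fullrankfun Afull l) i = chi i (g l) by rewrite /g; case: cid2.
exists g; split=> //; have := fullrowsub_unit Afull; rewrite unitmxE unitfE -det_tr.
by congr (\det _ != 0); apply/matrixP => i l; rewrite !mxE -gE mxE.
Qed.

End SymbolEvaluation.

(** * Symbols of infinitesimals *)

Section SymbolsOfInfinitesimals.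
Variables (F Fs : fieldType) (j : {rmorphism F -> Fs}).
Hypothesis sep : is_separable_closure j.
Variables (k : closedFieldType) (n : nat).
Variable ev : {rmorphism {mpoly k[n]} -> Fs}.
Hypothesis ev_inj : injective ev.
Variable Ok : valring k.
Hypothesis Ok2 : 2%:R \notin vmax Ok.
Variable lam : 'I_n -> k.
Hypothesis lam_max : forall i, lam i \in vmax Ok.
Variable a : 'I_n -> F.
Hypothesis aE : forall i, j (a i) = ev 'X_i.
Variable y : 'I_n -> Fs.
Local Notation rho := (ev \o @mpolyC n k).
Local Notation x i := (ev 'X_i).
Hypothesis yE : forall i, y i ^+ 2 = x i * (x i - 1) * (x i - rho (lam i)).
Hypothesis F_gen : forall N : divringClosed Fs, (forall c, rho c \in N) ->
  (forall i, x i \in N) -> (forall i, y i \in N) -> forall b, j b \in N.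

Lemma closed_sqrt (b : k) : exists c, c ^+ 2 = b.
Proof.
have [|c] := @closed_rootP k ('X^2 - b%:P) _; last first.
  by rewrite /root !hornerE subr_eq0 => /eqP <-; exists c.
by rewrite size_XnsubC.
Qed.

Lemma symbol_infinitesimal_neq0 : symbol j a <> 0.
Proof.
have [O [O_int O_small]] := monomial_valring ev_inj Ok.
have k2 : (2%:R : k) != 0 by apply: contraNneq Ok2 => ->; exact: rpred0.
have Fs2 : (2%:R : Fs) != 0 by rewrite -(rmorph_nat rho) fmorph_eq0.
have vmax2 : 2%:R \notin vmax O.
  rewrite vmaxE negb_or Fs2 negbK /= -(rmorph_nat rho) -fmorphV.
  by apply: (rho_valring O_int); exact: nvmaxV.
pose T := monomial ev.
have T_neq0 := monomial_neq0 ev_inj; have TM := @monomialM _ _ _ ev.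
have TV := @monomialV _ _ _ ev; have T_rho := monomial_rho ev_inj.
have T_unit := monomial_unit_const ev_inj O_small.
have [N0 N0P] : exists N0 : divringClosed Fs,
    forall z, z \in N0 <-> exists p q, z = ev p / ev q.
  have ev0 q : (ev q == 0) = (q == 0) by rewrite -(rmorph0 ev) (inj_eq ev_inj).
  apply: subfield_of_set.
  - by exists 1, 1; rewrite rmorph1 divr1.
  - move=> _ _ [p [q ->]] [p' [q' ->]].
    have [q0|q0] := eqVneq q 0.
      by exists (- p'), q'; rewrite q0 rmorph0 invr0 mulr0 sub0r rmorphN mulNr.
    have [q'0|q'0] := eqVneq q' 0.
      by exists p, q; rewrite q'0 rmorph0 invr0 mulr0 subr0.
    exists (p * q' - p' * q), (q * q').
    by rewrite subf_div ?ev0 // rmorphB !rmorphM.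
  - move=> _ _ [p [q ->]] [p' [q' ->]]; exists (p * p'), (q * q').
    by rewrite mulf_div !rmorphM.
  - by move=> _ [p [q ->]]; exists q, p; rewrite invf_div.
have [z /N0P[p [q ->]]|N N0N Nmax] := @maximal_subfield_exists _ O T N0.
  exact: (fraction_almost_monomial ev_inj O_small p q).
have evN p : ev p \in N by apply: N0N; apply/N0P; exists p, 1; rewrite rmorph1 divr1.
have U0 i : (U_(i)%MM <= (0%MM : 'X_{1..n}))%O = false.
  by apply/negP => /lemc_mdeg; rewrite mdeg1 mdeg0.
have x0 i : x i != 0 by exact: X_neq0.
have x_max i : x i \in vmax O.
  have := @monomial_small _ _ _ _ _ _ O_small 1 U_(i)%MM 0%MM (rpred1 _).
  by rewrite U0 mpolyX0 !rmorph1 mul1r divr1; apply.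
have lx_max i : rho (lam i) / x i \in vmax O.
  have := @monomial_small _ _ _ _ _ _ O_small (lam i) 0%MM U_(i)%MM (vmaxW (lam_max i)).
  by rewrite mpolyX0 rmorph1 mulr1; apply.
(* Division by [x i] and a square root of [-1] turns the Legendre equation into
   [r^2 = (1 - x) (1 - lam / x)], which lies in [1 + m]. *)
have yN i : y i \in N.
  have [c c2] := closed_sqrt (-1).
  have c20 : rho c ^+ 2 = -1 by rewrite -rmorphXn c2 rmorphN1.
  have c0 : rho c != 0.
    by apply/eqP => c0; move/eqP: c20; rewrite c0 expr0n eq_sym oppr_eq0 oner_eq0.
  pose r := y i / (x i * rho c).
  have -> : y i = r * (x i * rho c) by rewrite divfK // mulf_neq0.
  apply: rpredM; last by apply: rpredM; exact: evN.
  have r2 : r ^+ 2 = (1 - x i) * (1 - rho (lam i) / x i).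
    rewrite /r expr_div_n yE exprMn c20; move: (x0 i) => {}x0.
    by set l := rho _; set w := ev _ in x0 *; field; rewrite x0 oppr_eq0 oner_neq0.
  apply: (maximal_sqrt vmax2 Nmax); rewrite r2.
    by rewrite rpredM // rpredB ?rpred1 ?rpred_div //; exact: evN.
  apply: rpredM; rewrite voneE addrAC subrr add0r rpredN; [exact: x_max|exact: lx_max].
have jN : forall b, j b \in N by apply: F_gen => // ?; exact: evN.
pose r i := sqrt_in_closure j (a i).
have rE i : r i ^+ 2 = x i.
  rewrite /r /sqrt_in_closure -aE; case: xgetP => [z _ -> //|].
  have [_ Fs_root] := sep.
  move=> /= nr; have [||z] := Fs_root ('X^2 - (j (a i))%:P).
  - rewrite separable_poly.unlock derivB derivXn derivC subr0 expr1 -scaler_nat.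
    rewrite coprimepZr // -['X]subr0 -[0]/(0%:P) coprimep_XsubC /root !hornerE.
    by rewrite oppr0 expr0n sub0r oppr_eq0 aE.
  - by rewrite size_XnsubC.
  by rewrite /root !hornerE subr_eq0 => /eqP /nr.
pose chi i (s : gal j) := kummer_cochain (a i) (fun _ : 'I_1 => s).
have [e [i ei]|g [gN detg]] := @independent_tuple _ _ j n (fixes N) chi.
  apply: contrapT => noS; have echi s : fixes N s -> \sum_i e i * chi i s = 0.
    move=> sN; apply/eqP; apply: contraT => es; case: noS; by exists s.
  pose m := [multinom nat_of_bool (e l != 0%R) | l < n].
  (* A relation [e] among the Kummer characters makes this product invariant, hence an element of
     [N]. *)
  pose z := \prod_(l | e l != 0) r l.
  have z2 : z ^+ 2 = ev 'X_[m].
    rewrite mpolyXE_id rmorph_prod /= -prodrXl big_mkcond; apply: eq_bigr => l _.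
    by rewrite mnmE rmorphXn; case: eqP => _ //=; rewrite rE expr1.
  have zN : z \in N.
    apply: (fixed_in sep jN) => s sN; rewrite rmorph_prod /=.
    have sr l : s (r l) = (-1) ^+ (s (r l) != r l) * r l.
      have [->|->] := gal_sqrt_in_closure (a l) s; first by rewrite eqxx mul1r.
      by case: eqP => [->|_]; rewrite ?mul1r ?mulN1r.
    rewrite (eq_bigr _ (fun l _ => sr l)) big_split /= prodrXr -signr_odd.
    suff -> : odd (\sum_(l | e l != 0) (s (r l) != r l)) = false by rewrite mul1r.
    apply/negbTE; rewrite -dvdn2 (dvdn_pcharf (pchar_Fp (isT : prime 2))) natr_sum.
    apply/eqP; rewrite -[RHS](echi s sN) big_mkcond; apply: eq_bigr => l _.
    by have [->|->] := F2_eq01 (e l); rewrite ?mul0r ?mul1r.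
  have z0 : z != 0.
    apply/eqP => z0; have := X_neq0 ev_inj m.
    by rewrite -z2 z0 expr0n eqxx.
  have [NE _] := Nmax; case: (NE z zN) => [z00|[d [t [dodd Tt zt]]]].
    by rewrite z00 eqxx in z0.
  have [c [b [d' [c0 tE]]]] := Tt.
  (* Squaring replaces [z] by a true monomial, so independence of values gives
     [m *+ d + 2 d' = 2 b]. At [i] this fails modulo 2, because [m i = 1] and [d] is odd. *)
  have unit2 : rho (c ^- 2) * ev 'X_[m *+ d + (d' + d')] / ev 'X_[b + b] \in vunit O.
    have -> : rho (c ^- 2) * ev 'X_[m *+ d + (d' + d')] / ev 'X_[b + b] =
        (z ^+ d / t) ^+ 2.
      have mE : ev 'X_[m *+ d] = (z ^+ 2) ^+ d by rewrite z2 -mpolyXn rmorphXn.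
      rewrite tE !XD mE -exprM mulnC exprM.
      have -> : rho (c ^- 2) = (rho c) ^- 2 by rewrite (fmorphV rho) (rmorphXn rho).
      have c1 : rho c != 0 by rewrite fmorph_eq0.
      have := X_neq0 ev_inj b; have := X_neq0 ev_inj d'.
      move: ((ev \o @mpolyC n k) c) (ev 'X_[b]) (ev 'X_[d']) (z ^+ d) c1 => c1 xb xd zd c10 xd0 xb0.
      by field; rewrite c10 xb0 xd0.
    by rewrite rpredX // vone_unit.
  have := monomial_unit O_small _ unit2; rewrite invr_eq0 expf_neq0 // => /(_ isT).
  move=> /mnmP/(_ i); rewrite !mnmDE mulmnE mnmE ei mul1n => /(congr1 odd).
  by rewrite !oddD !addbb addbF dodd.
apply: (symbol_neq0 (g := g)) => // l l'.
have rhoN c : rho c \in N by exact: evN.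
exact: (fixes_commute sep T_neq0 TM TV T_rho T_unit vmax2 jN rhoN Nmax).
Qed.

End SymbolsOfInfinitesimals.

(** * Legendre coordinates *)

Lemma kronecker_inj (B n : nat) (u v : 'I_n -> nat) :
  (forall i, (u i < B)%N) -> (forall i, (v i < B)%N) ->
  (\sum_i u i * B ^ i = \sum_i v i * B ^ i)%N -> u =1 v.
Proof.
elim: n u v => [|n IH] u v uB vB uv i; first by case: i.
have B0 : (0 < B)%N by exact: leq_trans (uB ord0).
have split_sum (w : 'I_n.+1 -> nat) :
    (\sum_l w l * B ^ l = w ord0 + B * \sum_l w (lift ord0 l) * B ^ l)%N.
  rewrite big_ord_recl expn0 muln1 big_distrr /=; congr (_ + _)%N.
  by apply: eq_bigr => l _; rewrite /bump /= add1n expnS mulnCA.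
move: uv; rewrite !split_sum => uv.
have uv0 : u ord0 = v ord0.
  have := congr1 (modn^~ B) uv; rewrite ![(_ + B * _)%N]addnC ![(B * _)%N]mulnC.
  by rewrite !modnMDl !modn_small.
move: uv; rewrite uv0 => /addnI/eqP; rewrite eqn_pmul2l // => /eqP uv.
have uvS := IH (fun l => u (lift ord0 l)) (fun l => v (lift ord0 l)) _ _ uv.
case: (unliftP ord0 i) => [l ->|-> //].
by apply: uvS => ?; rewrite ?uB ?vB.
Qed.

(** A root of [q * 'X + 1] cannot be a root of [q]. *)
Lemma closed_field_nonroot (k : closedFieldType) (q : {poly k}) : q != 0 ->
  exists t, ~~ root q t.
Proof.
move=> q0; have [|t] := @closed_rootP k (q * 'X + 1%:P) _.
  by rewrite size_MXaddC (negPf q0) /= eqSS size_poly_eq0.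
rewrite /root !hornerE => qt; exists t; apply: contraTN qt => /eqP ->.
by rewrite mul0r add0r oner_eq0.
Qed.

(* Kronecker substitution [X_i := t ^ (B ^ i)]. *)
Lemma mpoly_eval_neq0 (k : closedFieldType) n (p : {mpoly k[n]}) : p != 0 ->
  exists u : 'I_n -> k, p.@[u] != 0.
Proof.
move=> p0; pose B := (\max_(m <- msupp p) \max_i m i).+1.
have mB m i : m \in msupp p -> (m i < B)%N.
  move=> mp; rewrite /B ltnS (leq_trans _ (leq_bigmax_seq _ mp _)) //.
  exact: leq_bigmax.
pose wt (m : 'X_{1..n}) := (\sum_i m i * B ^ i)%N.
pose q : {poly k} := \sum_(m <- msupp p) p@_m *: 'X^(wt m).
have q0 : q != 0.
  apply/eqP => /(congr1 (fun r : {poly k} => r`_(wt (mlead p)))).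
  rewrite coef0 coef_sum (bigD1_seq (mlead p)) ?msupp_uniq ?mlead_supp //=.
  rewrite coefZ coefXn eqxx mulr1 big1_seq ?addr0 => [|m /andP[mlead_m mp]].
    by apply/eqP; rewrite mleadc_eq0.
  rewrite coefZ coefXn; case: eqP => [wtE|_]; last by rewrite mulr0.
  case/eqP: mlead_m; apply/mnmP; apply: (@kronecker_inj B) => // i; apply: mB => //.
  exact: mlead_supp.
have [t qt] := closed_field_nonroot q0.
exists (fun i => t ^+ (B ^ i)); move: qt; rewrite /root /q horner_sum mevalE.
congr (_ != _); apply: eq_bigr => m _; rewrite hornerZ hornerXn; congr (_ * _).
rewrite /wt -prodrXr; apply: eq_bigr => i _.
by rewrite -exprM mulnC.
Qed.

Local Open Scope quotient_scope.

(** * Extension of [v0] to the algebraically closed field [k] *)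

Section DiscreteValuation.
Variables (k0 : fieldType) (v0 : discrete_valuation k0).
Hypothesis residue_char : 2%N \notin [pchar (residue_field v0)].

Lemma dval2 : (2%:R : k0) != 0 /\ v0 2%:R = 0.
Proof.
have res2 : (2%:R : residue_field v0) != 0.
  by apply: contra residue_char => res2; rewrite inE /= res2.
have : (2%:R : valuation_ring v0) \notin @valuation_ideal k0 v0.
  apply: contra res2 => v2.
  have <- : \pi_(residue_field v0) (2%:R : valuation_ring v0) = 2%:R by rewrite rmorph_nat.
  by rewrite -(rmorph0 \pi_(residue_field v0)) -Quotient.idealrBE subr0.
rewrite /in_mem /= /valuation_ideal negb_or => /andP[n20 v2].
have vE : \val (2%:R : valuation_ring v0) = 2%:R by rewrite rmorph_nat.
rewrite vE in n20 v2; split=> //.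
have := valP (2%:R : valuation_ring v0).
rewrite vE /in_mem /= /valuation_pred (negPf n20) /= => v2'.
by apply/eqP; rewrite eq_le v2' andbT leNgt.
Qed.

Lemma valring_of_dval (k : fieldType) (iota : {rmorphism k0 -> k}) :
  exists O : valring k, 2%:R \notin vmax O /\
    forall z, z != 0 -> 0 < v0 z -> iota z \in vmax O.
Proof.
pose U t := exists w : valuation_ring v0, t = iota (val w).
pose V t := exists2 w : valuation_ring v0, w \in @valuation_ideal k0 v0 & t = iota (val w).
have [V0 V1 VD] := valuation_ideal_closed v0.
have [|O [UO VO]] := @valring_exists k U V.
  split.
  - split; first by exists 1; rewrite !rmorph1.
      by move=> _ _ [w ->] [w' ->]; exists (w - w'); rewrite !rmorphB.
    by move=> _ _ [w ->] [w' ->]; exists (w * w'); rewrite !rmorphM.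
  - by move=> _ [w _ ->]; exists w.
  - by exists 0; rewrite ?rmorph0.
  - move=> _ _ [w wV ->] [w' w'V ->]; exists (-1 * w' + w); first exact: VD.
    (* The ideal axioms are packaged as closure under [a * x + y]; differences and multiples are put
       in this form. *)
    have -> : -1 * w' + w = w - w' by rewrite mulN1r addrC.
    by rewrite !rmorphB.
  - split.
      move=> _ _ [w ->] [w' w'V ->]; exists (w * w' + 0); first exact: VD.
      by rewrite addr0 !rmorphM.
    move=> [w wV /esym/eqP]; rewrite fmorph_eq1 => /eqP w1.
    by case/negP: V1; have -> : 1 = w by apply: val_inj.
have [n20 v2] := dval2.
exists O; split.
  rewrite vmaxE negb_or negbK -(rmorph_nat iota) fmorph_eq0 n20 /= -fmorphV.
  apply: UO; have h : (2%:R : k0)^-1 \in @valuation_pred k0 v0.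
    by rewrite /in_mem /= /valuation_pred dvalV // v2 oppr0 lexx orbT.
  by exists (ValuationRing h).
move=> z z0 vz; apply: VO; have h : z \in @valuation_pred k0 v0.
  by rewrite /in_mem /= /valuation_pred ltW ?orbT.
by exists (ValuationRing h) => //; rewrite /in_mem /= /valuation_ideal /= vz orbT.
Qed.

End DiscreteValuation.

Section LegendreCoordinates.
Variables (k : closedFieldType) (n : nat) (lam : 'I_n -> k) (K : fieldType).
Variable Y : legendre_function_field lam K.

Definition x_embedding : {mpoly k[n]} -> {mpoly k[n + n]} :=
  mmap (@mpolyC (n + n) k) (@legendre_x k n).

HB.instance Definition _ := GRing.RMorphism.on x_embedding.

(** A polynomial in the [x_i] that lies in the Legendre ideal vanishes at every point of affine
    space, since over [k] the equations can be solved for the [y_i]; so it is zero. *)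
Lemma x_embedding_inj : injective (Y \o x_embedding).
Proof.
apply: raddf_inj => p /= /(coord_ker Y)[c pE].
apply/eqP; apply: contraT => /mpoly_eval_neq0[u /negP[]].
pose w i := projT1 (cid (@closed_sqrt k (u i * (u i - 1) * (u i - lam i)))).
have wE i : w i ^+ 2 = u i * (u i - 1) * (u i - lam i) by rewrite /w; case: cid.
pose v (i : 'I_(n + n)) := match fintype.split i with inl l => u l | inr l => w l end.
have vx i : meval v (legendre_x k i) = u i.
  by rewrite /legendre_x mevalXU /v (unsplitK (inl i)).
have vy i : meval v (legendre_y k i) = w i.
  by rewrite /legendre_y mevalXU /v (unsplitK (inr i)).
have -> : p.@[u] = meval v (x_embedding p).
  rewrite /x_embedding /mmap mevalE rmorph_sum /=; apply: eq_bigr => m _.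
  rewrite mevalM mevalC; congr (_ * _); rewrite /mmap1 rmorph_prod /=.
  by apply: eq_bigr => i _; rewrite rmorphXn /= vx.
rewrite pE rmorph_sum /= big1 // => i _; rewrite mevalM.
rewrite [X in _ * X](_ : _ = 0) ?mulr0 //.
by rewrite /legendre_eq mevalB rmorphXn /= vy wE !mevalM !mevalB meval1 mevalC vx subrr.
Qed.

Lemma coord_gen (N : divringClosed K) : (forall c, Y c%:MP \in N) ->
  (forall i, Y (legendre_x k i) \in N) -> (forall i, Y (legendre_y k i) \in N) ->
  forall z, z \in N.
Proof.
move=> cN xN yN; have pN p : Y p \in N.
  rewrite [p]mpolyE rmorph_sum; apply: rpred_sum => m _.
  rewrite -mul_mpolyC rmorphM mpolyXE_id rmorph_prod; apply: rpredM => //.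
  apply: rpred_prod => i _; rewrite rmorphXn; apply: rpredX.
  by have [l ->|l ->] := split_ordP i; [exact: xN|exact: yN].
by move=> z; have [p [q [_ ->]]] := coord_frac Y z; exact: rpred_div.
Qed.

End LegendreCoordinates.
Theorem theorem3p3
  (k0 : fieldType) (v0 : discrete_valuation k0)
  (residue_char : 2%N \notin [pchar (residue_field v0)])
  (n : nat) (lam : 'I_n -> k0)
  (lam_neq0 : forall i, lam i != 0) (lam_neq1 : forall i, lam i != 1)
  (lam_val : forall i, 0 < v0 (lam i))
  (k : closedFieldType) (iota : {rmorphism k0 -> k})
  (kY : fieldType)
  (Y : legendre_function_field (fun i => iota (lam i)) kY)
  (kYs : fieldType) (j : {rmorphism kY -> kYs})
  (kYs_sep : is_separable_closure j) :
  symbol j (fun i => Y (legendre_x k i)) <> 0.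
Proof.
have [Ok [Ok2 Ok_max]] := valring_of_dval residue_char iota.
pose ev : {rmorphism {mpoly k[n]} -> kYs} := j \o (Y \o @x_embedding k n).
have ev_inj : injective ev by apply: inj_comp; [exact: fmorph_inj|exact: x_embedding_inj].
have evX i : ev 'X_i = j (Y (legendre_x k i)).
  by rewrite /ev /= /x_embedding mmapX mmap1U.
have evC c : ev c%:MP = j (Y c%:MP) by rewrite /ev /= /x_embedding mmapC.
apply: (@symbol_infinitesimal_neq0 _ _ _ kYs_sep _ _ ev ev_inj _ Ok2
  (fun i => iota (lam i)) _ _ _ (fun i => j (Y (legendre_y k i)))) => //.
- by move=> i; apply: Ok_max.
- move=> i; rewrite evX -[X in _ = _ * (_ - X)]/(ev (iota (lam i))%:MP) evC -!rmorphXn -(rmorph1 j) -(rmorph1 Y).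
  rewrite -!rmorphB -!rmorphM; congr (j _); apply/eqP; rewrite -subr_eq0 -rmorphB.
  (* The difference of the two sides is the [i]-th generator of the kernel, whence Kronecker delta
     coefficients. *)
  apply/eqP/(coord_ker Y); exists (fun l => (l == i)%:R).
  rewrite (bigD1 i) //= eqxx mul1r big1 ?addr0 // => l /negPf ->.
  by rewrite mul0r.
- move=> N cN xN yN b.
  (* The subfield is pulled back along [j], because the coordinates generate [kY] and not [kYs]. *)
  have [M MP] : exists M : divringClosed kY, forall z, z \in M <-> j z \in N.
    apply: (@subfield_of_set _ (fun z => j z \in N)).
    + by rewrite rmorph1 rpred1.
    + by move=> x y xM yM; rewrite rmorphB rpredB.
    + by move=> x y xM yM; rewrite rmorphM rpredM.
    + by move=> x xM; rewrite fmorphV rpredV.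
  apply/MP; apply: (coord_gen (Y := Y)) => [c|i|i]; apply/MP.
  + by rewrite -evC; exact: cN.
  + by rewrite -evX; exact: xN.
  + exact: yN.
Qed.
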